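(* Let $N=2$ and let $F$ be a marginal distribution on $[0,1]$ as described in the context, with density $f$ on $(0,1)$ and point mass $\Pr(1)$ at $1$. Suppose the robust-version regularity conditions hold: $x^2 f(x)$ is non-decreasing on $(0,1)$ and $\Pr(1)\ge \int_{(0,1)} x^2 f(x)\,dx$. Then the Second Price Auction with Uniformly Distributed Reserves $(q^*,t^* )$ and the Adversarial Correlation Structure $\pi^*$ form a Nash equilibrium (saddle point) of the zero-sum game between the auctioneer, who chooses a DSIC and EPIR mechanism, and Nature, who chooses $\pi\in\Pi(F)$; that is, $\pi^*\in\Pi(F)$ and $$U((q^*,t^* ),\pi)\ \ge\ U((q^*,t^* ),\pi^* )\ \ge\ U((q,t),\pi^* )$$ for every $\pi\in\Pi(F)$ and every DSIC and EPIR mechanism $(q,t)$. Moreover, the revenue guarantee of $(q^*,t^* )$, i.e. $\inf_{\pi\in\Pi(F)}U((q^*,t^* ),\pi)$, equals $E[X^2]$ where $X\sim F$.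
   Context: A single indivisible good is sold to two risk-neutral bidders with private values $v_1,v_2\in[0,1]$. Both bidders' values have the same marginal cumulative distribution function $F$ on $[0,1]$ whose support is $[0,1]$; $F$ may have point masses at $0$ and at $1$ and is absolutely continuous on $(0,1)$ with density $f$; $\Pr(1)$ denotes the probability mass of $F$ at $1$ (if $F$ has a point mass at $0$, write $f(0)$ for $\Pr(0)$). $\Pi(F)$ is the set of Borel probability measures on $[0,1]^2$ both of whose one-dimensional marginals equal $F$. A (direct) mechanism is a pair $(q,t)$ with $q:[0,1]^2\to[0,1]^2$, $q_1(v)+q_2(v)\le 1$, and $t:[0,1]^2\to\mathbb{R}^2$. It is DSIC if $v_iq_i(v)-t_i(v)\ge v_iq_i(v_i',v_{-i})-t_i(v_i',v_{-i})$ for all $i,v,v_i'$, and EPIR if $v_iq_i(v)-t_i(v)\ge 0$ for all $i,v$. The expected revenue of $(q,t)$ under $\pi$ is $U((q,t),\pi)=\int_{[0,1]^2}(t_1(v)+t_2(v))\,d\pi(v)$. Second Price Auction with Uniformly Distributed Reserves $(q^*,t^* )$: if $v_1>v_2$, then $q_1^*=v_1$, $q_2^*=0$, $t_1^*=\frac{v_1^2+v_2^2}{2}$, $t_2^*=0$; symmetrically if $v_2>v_1$; if $v_1=v_2=v$, then $q_1^*=q_2^*=\frac v2$ and $t_1^*=t_2^*=\frac{v^2}{2}$. Adversarial Correlation Structure $\pi^*$: a symmetric distribution on $[0,1]^2$ which places all the marginal weight of $F$ at $0$ on the profile $(0,0)$ (weight $f(0)$ there), places no weight on profiles where exactly one value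 is $0$, has density $\pi^*(v_1,v_2)=\pi^*(v_2,v_1)=\frac{1}{v_1^2}\Big(v_2f(v_2)-\frac{\int_0^{v_2}s^2f(s)\,ds}{v_2^2}\Big)$ (w.r.t. two-dimensional Lebesgue measure) for $0<v_2\le v_1<1$, has one-dimensional density $v_2f(v_2)-\frac{\int_0^{v_2}s^2f(s)\,ds}{v_2^2}$ (w.r.t. $dv_2$) on the segment $\{1\}\times(0,1)$ and symmetrically on $(0,1)\times\{1\}$, and has a point mass $\Pr(1)-\int_{(0,1)}s^2f(s)\,ds$ at $(1,1)$. *)

(* Defs.v *)
From HB Require Import structures.
From mathcomp Require Import all_boot all_order all_algebra.
From mathcomp Require Import all_classical all_reals all_analysis.
Set Implicit Arguments. Unset Strict Implicit. Unset Printing Implicit Defensive.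
Import Order.TTheory GRing.Theory Num.Theory.
Local Open Scope classical_set_scope.
Local Open Scope ring_scope.

Section Defs.
Variable R : realType.
Notation leb := (@lebesgue_measure R).

Definition I01 : set R := `[0, 1]%classic.
Definition O01 : set R := `]0, 1[%classic.

Definition Fmeas (p0 p1 : R) (f : R -> R) (A : set R) : \bar R :=
  ((p0 * \1_A 0 + p1 * \1_A 1)%:E +
   \int[leb]_(x in A `&` O01) (f x)%:E)%E.

(** Standing assumptions on F: a probability distribution on [0,1] with
    atoms only at 0 and 1, absolutely continuous on (0,1) with density f,
    and with support [0,1] (every open subinterval of (0,1) has positive mass). *)
Definition marginal_ok (p0 p1 : R) (f : R -> R) : Prop :=
  [/\ 0 <= p0, 0 <= p1,
      measurable_fun O01 f,
      (forall x, 0 < x < 1 -> 0 <= f x) &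
      ((p0 + p1)%:E + \int[leb]_(x in O01) (f x)%:E = 1)%E] /\
      (forall a b : R, 0 <= a -> a < b -> b <= 1 ->
         (0 < \int[leb]_(x in `]a, b[) (f x)%:E)%E).

(** Pi(F): Borel probability measures on [0,1]^2 (i.e. on R x R, necessarily
    concentrated on [0,1]^2) both of whose one-dimensional marginals equal F. *)
Definition PiF (p0 p1 : R) (f : R -> R) : set (probability (R * R)%type R) :=
  [set pi | forall A : set R, measurable A ->
      pi (A `*` setT) = Fmeas p0 p1 f A /\ pi (setT `*` A) = Fmeas p0 p1 f A].

(** A mechanism is given by allocations q1 q2 and payments t1 t2
    (functions of the value profile v = (v1, v2)); only their values on
    [0,1]^2 matter. *)
Definition feasible (q1 q2 : R * R -> R) : Prop :=
  forall v : R * R, v.1 \in I01 -> v.2 \in I01 ->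
    [/\ 0 <= q1 v <= 1, 0 <= q2 v <= 1 & q1 v + q2 v <= 1].

Definition DSIC (q1 q2 t1 t2 : R * R -> R) : Prop :=
  (forall v1 v2 w1 : R, v1 \in I01 -> v2 \in I01 -> w1 \in I01 ->
     v1 * q1 (v1, v2) - t1 (v1, v2) >= v1 * q1 (w1, v2) - t1 (w1, v2)) /\
  (forall v1 v2 w2 : R, v1 \in I01 -> v2 \in I01 -> w2 \in I01 ->
     v2 * q2 (v1, v2) - t2 (v1, v2) >= v2 * q2 (v1, w2) - t2 (v1, w2)).

Definition EPIR (q1 q2 t1 t2 : R * R -> R) : Prop :=
  forall v : R * R, v.1 \in I01 -> v.2 \in I01 ->
    0 <= v.1 * q1 v - t1 v /\ 0 <= v.2 * q2 v - t2 v.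

Definition revenue (t1 t2 : R * R -> R) (pi : probability (R * R)%type R)
  : \bar R := (\int[pi]_v (t1 v + t2 v)%:E)%E.

Definition qstar1 (v : R * R) : R :=
  if v.2 < v.1 then v.1 else if v.1 == v.2 then v.1 / 2 else 0.
Definition qstar2 (v : R * R) : R :=
  if v.1 < v.2 then v.2 else if v.1 == v.2 then v.2 / 2 else 0.
Definition tstar1 (v : R * R) : R :=
  if v.2 < v.1 then (v.1 ^+ 2 + v.2 ^+ 2) / 2
  else if v.1 == v.2 then v.1 ^+ 2 / 2 else 0.
Definition tstar2 (v : R * R) : R :=
  if v.1 < v.2 then (v.1 ^+ 2 + v.2 ^+ 2) / 2
  else if v.1 == v.2 then v.2 ^+ 2 / 2 else 0.

Definition gdens (f : R -> R) (y : R) : R :=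
  y * f y - Rintegral leb `]0, y[ (fun s => s ^+ 2 * f s) / y ^+ 2.

Definition pistar_fun (p0 p1 : R) (f : R -> R) (A : set (R * R)) : \bar R :=
  ((p0 * \1_A (0, 0))%:E
   + \int[leb \x leb]_(v in A `&` (O01 `*` O01))
        (gdens f (Order.min v.1 v.2) / (Order.max v.1 v.2) ^+ 2)%:E
   + \int[leb]_(x in O01) (\1_A (1, x) * gdens f x)%:E
   + \int[leb]_(x in O01) (\1_A (x, 1) * gdens f x)%:E
   + ((p1 - Rintegral leb O01 (fun s => s ^+ 2 * f s)) * \1_A (1, 1))%:E)%E.

End Defs.
Arguments I01 {R}.
Arguments O01 {R}.

(* Main.v *)
Require Import Defs.
From HB Require Import structures.
From mathcomp Require Import all_boot all_order all_algebra.
From mathcomp Require Import all_classical all_reals all_analysis.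
From mathcomp Require Import measurable_realfun ring lra.
Import Order.TTheory GRing.Theory Num.Theory.
Import numFieldNormedType.Exports.
Local Open Scope classical_set_scope.
Local Open Scope ring_scope.
Set Implicit Arguments. Unset Strict Implicit. Unset Printing Implicit Defensive.

(* Under the uniform-reserve auction the total payment is (v1^2 + v2^2) / 2 at
   every profile, so its revenue is E[X^2] under every correlation structure
   with marginals F.  Conversely, write h(x) = x^2 f(x),
   G(x) = \int_0^x h and g = gdens f; Tonelli gives \int_0^x g = G(x) / x, from
   which the marginals of the adversarial structure follow.  Against it, for a
   rival value y in (0,1), the virtual value of a bidder with value x is zero for
   y < x < 1, nonpositive for x < y because h is non-decreasing, and equal to 1 at
   x = 1; for y = 1 its product with the density is at most g(x), which is the
   surplus forgone by the rival with value 1 when the other bidder wins.  Summing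
   both bidders, the revenue is at most 2 G(1) + (Pr(1) - G(1)) = E[X^2].  The allocation of a
   mechanism need not be jointly measurable, so all integrals over profiles are
   of payments, and allocations are integrated along single sections only, where
   they are monotone. *)

(** * Measures given by a density *)

Section density_measure.
Context d (T : measurableType d) (R : realType) (mu : {measure set T -> \bar R}).
Variable w : T -> R.
Local Open Scope ereal_scope.

(* The proofs are arguments so that the measure instance can be inferred. *)
Definition density_measure of measurable_fun setT w & (forall x, 0 <= w x)%R :=
  fun A : set T => \int[mu]_(x in A) (w x)%:E.

Hypotheses (mw : measurable_fun setT w) (w0 : forall x, (0 <= w x)%R).
Local Notation nu := (density_measure mw w0).

Let density_measure0 : nu set0 = 0.
Proof. exact: integral_set0. Qed.

Let density_measure_ge0 A : 0 <= nu A.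
Proof. by apply: integral_ge0 => x _; rewrite lee_fin. Qed.

Let density_measure_sigma_additive : semi_sigma_additive nu.
Proof.
move=> /= A mA tA mUA; rewrite /density_measure ge0_integral_bigcup//=.
- apply: is_cvg_ereal_nneg_natsum_cond => n _ _; exact: density_measure_ge0.
- by apply/measurable_EFinP; exact: measurable_funTS.
- by move=> x _; rewrite lee_fin.
Qed.

HB.instance Definition _ := isMeasure.Build _ _ _ nu
  density_measure0 density_measure_ge0 density_measure_sigma_additive.

Import HBNNSimple.

(** Monotone convergence along simple approximations, applied on both sides, reduces the claim to
    indicators, where it is the definition of [density_measure]. *)
Lemma ge0_integral_density_measure (f : T -> \bar R) :
  measurable_fun setT f -> (forall x, 0 <= f x) ->
  \int[nu]_x f x = \int[mu]_x (f x * (w x)%:E).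
Proof.
move=> mf f0; pose h := nnsfun_approx measurableT mf.
have hf x : (EFin \o h n) x @[n --> \oo] --> f x.
  exact: cvg_nnsfun_approx.
have nd x : {homo (fun n => h n x) : a b / (a <= b)%N >-> (a <= b)%R}.
  by move=> a b ab /=; have /lefP := nd_nnsfun_approx measurableT mf ab.
have mEw : measurable_fun setT (EFin \o w) by exact/measurable_EFinP.
transitivity (limn (fun n => \int[nu]_x (h n x)%:E)).
  rewrite -monotone_convergence//.
  - by apply: eq_integral => x _; apply/esym/cvg_lim => //; exact: hf.
  - by move=> n; exact/measurable_EFinP.
  - by move=> n x _; rewrite lee_fin.
  - by move=> x _ a b ab; rewrite lee_fin nd.
transitivity (limn (fun n => \int[mu]_x ((h n x)%:E * (w x)%:E))); last first.
  rewrite -monotone_convergence//.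
  - apply: eq_integral => x _; apply/cvg_lim => //.
    exact: cvgeZr (hf x).
  - by move=> n; apply: emeasurable_funM => //; exact/measurable_EFinP.
  - by move=> n x _; rewrite mule_ge0 ?lee_fin.
  - by move=> x _ a b ab; rewrite lee_wpmul2r ?lee_fin ?nd.
congr (limn _); apply/funext => n.
under [LHS]eq_integral => x _ do rewrite fimfunE -fsumEFin//.
under [RHS]eq_integral => x _ do rewrite [h n x]fimfunE -fsumEFin//.
have mi r : measurable_fun setT (fun x => (r * \1_(h n @^-1` [set r]) x)%:E).
  exact/measurable_EFinP/measurable_funM.
rewrite ge0_integral_fsum//; last by move=> *; exact: nnfun_muleindic_ge0.
under [RHS]eq_integral => x _.
  rewrite ge0_mule_fsuml; last by move=> *; exact: nnfun_muleindic_ge0.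
  over.
rewrite ge0_integral_fsum//; last 2 first.
- by move=> r; exact: emeasurable_funM.
- move=> r x _; apply: mule_ge0; last by rewrite lee_fin.
  exact: nnfun_muleindic_ge0.
apply: eq_fsbigr => r rh.
have r0 : (0 <= r)%R by move: rh; rewrite inE => -[x _ <-].
under eq_integral do rewrite EFinM.
have mI : measurable_fun setT (fun x => (\1_(h n @^-1` [set r]) x : R)%:E).
  exact: measurableT_comp.
have I0 x : 0 <= (\1_(h n @^-1` [set r]) x : R)%:E by rewrite lee_fin.
rewrite ge0_integralZl//.
under [RHS]eq_integral do rewrite EFinM -muleA.
rewrite [RHS]ge0_integralZl//; last 2 first.
- exact: emeasurable_funM.
- by move=> x _; rewrite mule_ge0 ?lee_fin.
congr (_ * _); rewrite integral_indic// setIT /density_measure.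
rewrite [LHS]integral_mkcond; apply: eq_integral => x _.
by rewrite patchE indicE; case: ifPn => _; rewrite ?mul1e ?mul0e.
Qed.

End density_measure.

(** * Tonelli on a rectangle *)

Section tonelli_on.
Context (R : realType).
Local Notation leb := (@lebesgue_measure R).
Local Open Scope ereal_scope.
Variables (D E : set R) (f : R * R -> \bar R).
Hypotheses (mD : measurable D) (mE : measurable E).
Hypotheses (mf : measurable_fun (D `*` E) f) (f0 : forall z, (D `*` E) z -> 0 <= f z).

Let mDE : measurable (D `*` E). Proof. exact: measurableX. Qed.

Let mfDE : measurable_fun setT (f \_ (D `*` E)).
Proof. exact/(measurable_restrictT _ mDE). Qed.

Let fDE0 z : 0 <= (f \_ (D `*` E)) z.
Proof. exact: erestrict_ge0. Qed.

(** Extending [f] by zero off the rectangle gives access to Tonelli on the whole plane; [inner] and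
    [outer] identify the section integrals of the extension. *)
Let inner x : (\int[leb]_y (f \_ (D `*` E)) (x, y)) =
  ((fun x => \int[leb]_(y in E) f (x, y)) \_ D) x.
Proof.
rewrite [RHS]patchE; case: ifPn => xD.
  rewrite [RHS]integral_mkcond; apply: eq_integral => y _.
  by rewrite !patchE !in_setX xD.
by apply: integral0_eq => y _; rewrite patchE in_setX (negbTE xD).
Qed.

Let outer y : (\int[leb]_x (f \_ (D `*` E)) (x, y)) =
  ((fun y => \int[leb]_(x in D) f (x, y)) \_ E) y.
Proof.
rewrite [RHS]patchE; case: ifPn => yE.
  rewrite [RHS]integral_mkcond; apply: eq_integral => x _.
  by rewrite !patchE !in_setX yE andbT.
by apply: integral0_eq => x _; rewrite patchE in_setX (negbTE yE) andbF.
Qed.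

Lemma measurable_tonelli_on1 :
  measurable_fun D (fun x => \int[leb]_(y in E) f (x, y)).
Proof.
apply/(measurable_restrictT _ mD).
rewrite (_ : _ \_ _ = fubini_F leb (f \_ (D `*` E))).
  exact: measurable_fun_fubini_tonelli_F.
by apply/funext => x; rewrite -inner.
Qed.

Lemma measurable_tonelli_on2 :
  measurable_fun E (fun y => \int[leb]_(x in D) f (x, y)).
Proof.
apply/(measurable_restrictT _ mE).
rewrite (_ : _ \_ _ = fubini_G leb (f \_ (D `*` E))).
  exact: measurable_fun_fubini_tonelli_G.
by apply/funext => y; rewrite -outer.
Qed.

Lemma tonelli_on1 : \int[leb \x leb]_(z in D `*` E) f z =
  \int[leb]_(x in D) \int[leb]_(y in E) f (x, y).
Proof.
rewrite [LHS]integral_mkcond fubini_tonelli1// [RHS]integral_mkcond.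
by apply: eq_integral => x _; rewrite -inner.
Qed.

Lemma tonelli_on2 : \int[leb \x leb]_(z in D `*` E) f z =
  \int[leb]_(y in E) \int[leb]_(x in D) f (x, y).
Proof.
rewrite [LHS]integral_mkcond fubini_tonelli2// [RHS]integral_mkcond.
by apply: eq_integral => x _; rewrite -outer.
Qed.

End tonelli_on.

(** * Tonelli on a triangle, primitives and the integral of 1/y^2 *)

Section triangle.
Context (R : realType).
Local Notation leb := (@lebesgue_measure R).
Local Open Scope ereal_scope.

(** Both sides integrate [a y * b s] over the triangle 0 < s < y < c, in the two orders. *)
Lemma tonelli_triangle (c : R) (a b : R -> R) :
  measurable_fun `]0%R, c[ a -> measurable_fun `]0%R, c[ b ->
  (forall x, (0 < x < c)%R -> (0 <= a x)%R) ->
  (forall x, (0 < x < c)%R -> (0 <= b x)%R) ->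
  \int[leb]_(y in `]0%R, c[) ((a y)%:E * \int[leb]_(s in `]0%R, y[) (b s)%:E) =
  \int[leb]_(s in `]0%R, c[) ((b s)%:E * \int[leb]_(y in `]s, c[) (a y)%:E).
Proof.
move=> ma mb a0 b0.
pose D := [set` `]0%R, c[].
have DE x : D x = (0 < x < c)%R :> Prop by rewrite /D /= in_itv.
have mD : measurable D by exact: measurable_itv.
pose F (z : R * R) : \bar R := if (z.2 < z.1)%R then (a z.1 * b z.2)%:E else 0.
have mF : measurable_fun (D `*` D) F.
  have mDD : measurable (D `*` D) by exact: measurableX.
  apply: measurable_fun_if => //.
    by apply: measurable_fun_ltr; apply: measurable_funTS.
  apply: (@measurable_funS _ _ _ _ (D `*` D)) => //.
  apply/measurable_EFinP/measurable_funM.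
    apply: (@measurable_comp _ _ _ _ _ _ D) => //; last exact: measurable_funTS.
    by move=> _ [z [Dz _] <-].
  apply: (@measurable_comp _ _ _ _ _ _ D) => //; last exact: measurable_funTS.
  by move=> _ [z [_ Dz] <-].
have F0 z : (D `*` D) z -> 0 <= F z.
  case: z => y s [/= + +]; rewrite !DE /F /= => Dy Ds; case: ifP => // _.
  by rewrite lee_fin mulr_ge0 ?a0 ?b0.
transitivity (\int[leb]_(y in D) \int[leb]_(s in D) F (y, s)).
  apply: eq_integral => y /set_mem; rewrite ?/D /= in_itv/= => yD; have /andP[y0 yc] := yD.
  rewrite -ge0_integralZl//; last 3 first.
  - apply/measurable_EFinP; apply: measurable_funS mb => //.
    by move=> s /=; rewrite !in_itv/= => /andP[-> /lt_trans->].
  - move=> s /=; rewrite in_itv/= => /andP[s0 sy].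
    by rewrite lee_fin b0// s0 (lt_trans sy).
  - by rewrite lee_fin a0.
  rewrite (_ : [set` `]0%R, y[] = D `&` [set s | (s < y)%R]); last first.
    apply/seteqP; split => s; rewrite /D /= !in_itv/=.
      by move=> /andP[s0 sy]; rewrite s0 sy (lt_trans sy).
    by move=> [/andP[-> _] ->].
  rewrite integral_mkcondr; apply: eq_integral => s _.
  rewrite patchE /F /=; have [sy|/negP sy] := boolP (s < y)%R.
    by rewrite mem_set.
  by rewrite memNset.
transitivity (\int[leb]_(s in D) \int[leb]_(y in D) F (y, s)).
  by rewrite -tonelli_on1// tonelli_on2.
apply: eq_integral => s /set_mem; rewrite ?/D /= in_itv/= => sD; have /andP[s0 sc] := sD.
rewrite -ge0_integralZl//; last 3 first.
- apply/measurable_EFinP; apply: measurable_funS ma => //.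
  by move=> y /=; rewrite !in_itv/= => /andP[/(lt_trans s0)-> ->].
- move=> y /=; rewrite in_itv/= => /andP[sy yc].
  by rewrite lee_fin a0// yc (lt_trans s0).
- by rewrite lee_fin b0.
rewrite (_ : [set` `]s, c[] = D `&` [set y | (s < y)%R]); last first.
  apply/seteqP; split => y; rewrite /D /= !in_itv/=.
    by move=> /andP[sy yc]; rewrite sy yc (lt_trans s0).
  by move=> [/andP[_ ->] ->].
rewrite integral_mkcondr; apply: eq_integral => y _.
rewrite patchE /F /=; have [sy|/negP sy] := boolP (s < y)%R.
  by rewrite mem_set// mulrC.
by rewrite memNset.
Qed.

(** The relation [r] is left general so that one proof covers integrals up to a point and integrals
    from a point. *)
Lemma measurable_section_integral (D : set R) (r : R * R -> bool) (b : R -> R) :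
  measurable D -> measurable_fun setT r ->
  measurable_fun D b -> (forall x, D x -> (0 <= b x)%R) ->
  measurable_fun D (fun y => \int[leb]_(s in D `&` [set s | r (y, s)]) (b s)%:E).
Proof.
move=> mD mr mb b0.
pose F (z : R * R) : \bar R := if r z then (b z.2)%:E else 0.
have mF : measurable_fun (D `*` D) F.
  have mDD : measurable (D `*` D) by exact: measurableX.
  apply: measurable_fun_if => //; first exact: measurable_funTS.
  apply: (@measurable_funS _ _ _ _ (D `*` D)) => //.
  apply/measurable_EFinP.
  apply: (@measurable_comp _ _ _ _ _ _ D) => //; last exact: measurable_funTS.
  by move=> _ [z [_ Dz] <-].
have F0 z : (D `*` D) z -> 0 <= F z.
  by case: z => y s [/= _ Ds]; rewrite /F /=; case: ifP => // _; rewrite lee_fin b0.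
apply: (@eq_measurable_fun _ _ _ _ _ (fun y => \int[leb]_(s in D) F (y, s)));
  last exact: measurable_tonelli_on1.
move=> y _; rewrite integral_mkcondr; apply: eq_integral => s _.
rewrite patchE /F /=; have [sy|/negP sy] := boolP (r (y, s)).
  by rewrite mem_set.
by rewrite memNset.
Qed.

Lemma measurable_primitive (c : R) (b : R -> R) :
  measurable_fun `]0%R, c[ b -> (forall x, (0 < x < c)%R -> (0 <= b x)%R) ->
  measurable_fun `]0%R, c[ (fun y => \int[leb]_(s in `]0%R, y[) (b s)%:E).
Proof.
move=> mb b0.
have := @measurable_section_integral [set` `]0%R, c[] (fun z => z.2 < z.1)%R b.
move=> /(_ (measurable_itv _) (measurable_fun_ltr measurable_snd measurable_fst) mb).
move=> H; apply: eq_measurable_fun (H _).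
  move=> y /set_mem; rewrite /= in_itv/= => /andP[y0 yc].
  congr integral; apply/seteqP; split => s; rewrite /= !in_itv/=.
    by move=> [/andP[-> _] ->].
  by move=> /andP[s0 sy]; rewrite s0 sy (lt_trans sy).
by move=> x; rewrite /= in_itv; exact: b0.
Qed.

Lemma measurable_coprimitive (c : R) (b : R -> R) :
  measurable_fun `]0%R, c[ b -> (forall x, (0 < x < c)%R -> (0 <= b x)%R) ->
  measurable_fun `]0%R, c[ (fun s => \int[leb]_(y in `]s, c[) (b y)%:E).
Proof.
move=> mb b0.
have := @measurable_section_integral [set` `]0%R, c[] (fun z => z.1 < z.2)%R b.
move=> /(_ (measurable_itv _) (measurable_fun_ltr measurable_fst measurable_snd) mb).
move=> H; apply: eq_measurable_fun (H _).
  move=> s /set_mem; rewrite /= in_itv/= => /andP[s0 sc].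
  congr integral; apply/seteqP; split => y; rewrite /= !in_itv/=.
    by move=> [/andP[_ ->] ->].
  by move=> /andP[sy yc]; rewrite sy yc (lt_trans s0).
by move=> x; rewrite /= in_itv; exact: b0.
Qed.

(** Fundamental theorem of calculus with antiderivative -1/y on the closed interval, where 0 < s
    keeps the integrand continuous; the endpoints are null. *)
Lemma integral_invsq (s x : R) : (0 < s)%R -> (s <= x)%R ->
  \int[leb]_(y in `]s, x[) ((y ^+ 2)^-1)%:E = (s^-1 - x^-1)%:E.
Proof.
move=> s0; rewrite le_eqVlt => /predU1P[->|sx].
  by rewrite set_itvoo0 integral_set0 subrr.
have pos y : y \in `[s, x] -> (0 < y)%R.
  by rewrite in_itv/= => /andP[/(lt_le_trans s0)].
have dF (y : R) : (0 < y)%R -> is_derive y (1%R : R) (fun y : R => - y^-1 : R)%R ((y ^+ 2)^-1)%R.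
  move=> y0; have yN0 : y != 0%R by rewrite gt_eqF.
  have := is_deriveN (is_deriveV (f := id) yN0 (is_derive_id y (1%R : R))).
  by rewrite /GRing.scale/= mulr1 opprK -exprVn exprVn.
have cF (y : R) : (0 < y)%R -> {for y, continuous (fun y : R => - y^-1 : R)%R}.
  by move=> /dF[dF' _]; apply: differentiable_continuous; apply/derivable1_diffP.
have cf : {within `[s, x], continuous (fun y : R => (y ^+ 2)^-1)%R}.
  apply: continuous_in_subspaceT => y /set_mem /pos y0.
  apply: cvgV; first by rewrite expf_neq0// gt_eqF.
  exact: exprn_continuous.
have mf : measurable_fun `[s, x] (fun y : R => ((y ^+ 2)^-1)%:E).
  apply/measurable_EFinP; exact: subspace_continuous_measurable_fun.
transitivity (\int[leb]_(y in `[s, x]) ((y ^+ 2)^-1)%:E).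
  rewrite integral_itv_bndo_bndc; last first.
    by apply: measurable_funS mf => //; exact: subset_itv_oo_cc.
  rewrite integral_itv_obnd_cbnd//.
  by apply: measurable_funS mf => //; exact: subset_itv_oc_cc.
rewrite (@continuous_FTC2 _ _ (fun y : R => - y^-1)%R)//.
- by rewrite -EFinB opprK addrC.
- split.
  + by move=> y ys; have [] := dF y (pos y (subset_itv_oo_cc ys)).
  + by apply: cvg_at_right_filter; exact: cF.
  + by apply: cvg_at_left_filter; apply: cF; exact: lt_trans sx.
- move=> y ys; rewrite derive1E.
  by have [_ ->] := dF y (pos y (subset_itv_oo_cc ys)).
Qed.

End triangle.

(** * Envelope inequality and virtual surplus *)

Section envelope.
Context (R : realType).
Local Notation leb := (@lebesgue_measure R).

(* A left Riemann sum of [q] on a mesh of width [x / n] is at most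
   [u x - u 0], and it misses the integral by at most [x / n]. *)
Lemma envelope_le (q u : R -> R) (x : R) :
  {homo q : a b / a <= b} -> (forall a, 0 <= q a <= 1) ->
  (forall a b, 0 <= a -> a <= b -> b <= x -> q a * (b - a) <= u b - u a) ->
  0 <= x ->
  (\int[leb]_(s in `]0%R, x[) (q s)%:E <= (u x - u 0)%:E)%E.
Proof.
move=> qm q01 qu x0.
have mq D : measurable D -> measurable_fun D (EFin \o q).
  by move=> mD; apply/measurable_EFinP; exact: nondecreasing_measurable.
have q0 a : (0 <= (q a)%:E)%E by rewrite lee_fin; case/andP: (q01 a).
have step a b : a <= b ->
    (\int[leb]_(s in `]a, b]) (q s)%:E <= (q b * (b - a))%:E)%E.
  move=> ab; apply: (@le_trans _ _ (\int[leb]_(s in `]a, b]) (cst (q b)%:E) s)%E).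
    apply: ge0_le_integral => //; first exact: mq.
    by move=> s /=; rewrite in_itv/= lee_fin => /andP[_]; exact: qm.
  rewrite integral_cst//= lebesgue_measure_itv/= lte_fin.
  case: ifPn => _; first by rewrite -EFinD -EFinM.
  by rewrite mule0 lee_fin mulr_ge0 ?subr_ge0// -lee_fin.
(* Each cell is bounded by its right endpoint value; the excess over the left endpoint value is
   [d * (q b - q a)], and these excesses telescope. *)
have chain (d : R) k : 0 <= d -> d *+ k <= x ->
    (\int[leb]_(s in `]0%R, (d *+ k)%R]) (q s)%:E
      <= (u (d *+ k) - u 0 + d * (q (d *+ k) - q 0))%R%:E)%E.
  move=> d0; elim: k => [_|k IH dkx].
    by rewrite mulr0n !subrr mulr0 addr0 set_itvoc0 integral_set0.
  have dk : d *+ k <= d *+ k.+1 by rewrite mulrSr lerDl.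
  have dk0 : 0 <= d *+ k by exact: mulrn_wge0.
  have -> : `]0%R, d *+ k.+1]%classic =
      `]0%R, d *+ k]%classic `|` `]d *+ k, d *+ k.+1]%classic :> set R.
    by rewrite -itv_bndbnd_setU// bnd_simp.
  rewrite ge0_integral_setU//=; last 2 first.
  - by apply: mq; exact: measurableU.
  - apply/disj_setPS => s [/=]; rewrite !in_itv/= => /andP[_ h] /andP[h' _].
    by have := le_lt_trans h h'; rewrite ltxx.
  apply: le_trans (leeD (IH (le_trans dk dkx)) (step _ _ dk)) _.
  rewrite -EFinD lee_fin.
  have := qu _ _ dk0 dk dkx.
  have -> : d *+ k.+1 - d *+ k = d by rewrite mulrSr addrC addKr.
  by lra.
apply: (@le_trans _ _ (\int[leb]_(s in `]0%R, x]) (q s)%:E)%E).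
  apply: ge0_subset_integral => //; first exact: mq.
  exact: subset_itv_oo_oc.
apply/lee_addgt0Pr => e e0.
(* With this [n] the mesh width x / n is at most [e], and q x - q 0 <= 1 keeps the telescoped error
   below [e]. *)
pose n := (Num.truncn (x / e)).+1.
have n0 : 0 < n%:R :> R by rewrite ltr0n.
have xne : x / n%:R <= e.
  by rewrite ler_pdivrMr// mulrC -ler_pdivrMr// ltW// truncnS_gt.
have xE : (x / n%:R) *+ n = x.
  by rewrite -mulr_natr divfK// gt_eqF.
have xn0 : 0 <= x / n%:R by rewrite divr_ge0// ltW.
have := chain (x / n%:R) n xn0; rewrite xE => /(_ (lexx x)) /le_trans; apply.
rewrite -EFinD lee_fin.
have := q01 x; have := q01 0; have := qm _ _ x0.
move: (q x) (q 0) => b a; nra.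
Qed.

(* Fubini form of the virtual-value computation: for allocation [q] with
   payments bounded by the envelope formula, values of density [w] pay at most
   the virtual surplus. *)
Lemma payment_le_virtual_surplus (w q t : R -> R) :
  measurable_fun (`]0, 1[%classic : set R) w -> (forall x, 0 < x < 1 -> 0 <= w x) ->
  measurable_fun (`]0, 1[%classic : set R) t -> (forall x, 0 < x < 1 -> 0 <= t x) ->
  measurable_fun (`]0, 1[%classic : set R) q -> (forall x, 0 < x < 1 -> 0 <= q x) ->
  (forall x, 0 < x < 1 ->
    ((t x)%:E + \int[leb]_(s in `]0%R, x[) (q s)%:E <= (x * q x)%:E)%E) ->
  (\int[leb]_(x in `]0%R, 1%R[) (t x * w x)%:E +
   \int[leb]_(s in `]0%R, 1%R[) ((q s)%:E * \int[leb]_(x in `]s, 1%R[) (w x)%:E)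
   <= \int[leb]_(x in `]0%R, 1%R[) (q x * (x * w x))%:E)%E.
Proof.
move=> mw w0 mt t0 mq q0 tq.
have inO x : `]0%R, 1%R[%classic x -> (0 < x < 1 :> Prop) by rewrite /= in_itv.
have Q0 x : 0 < x < 1 -> (0 <= \int[leb]_(s in `]0%R, x[) (q s)%:E)%E.
  move=> /andP[_ x1]; apply: integral_ge0 => s /=; rewrite in_itv/= => /andP[s0 sx].
  by rewrite lee_fin q0// s0 (lt_trans sx).
(* Exchanging the order turns the second integral into that of the information rent (the integral of
   [q] up to the own value) against [w]; the inequality then holds pointwise. *)
rewrite -tonelli_triangle//.
have mQ : measurable_fun (`]0, 1[%classic : set R)
    (fun y => (w y)%:E * \int[leb]_(s in `]0%R, y[) (q s)%:E)%E.
  apply: emeasurable_funM; first exact/measurable_EFinP.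
  exact: measurable_primitive.
rewrite -ge0_integralD//; last 3 first.
- by move=> x /inO x1; rewrite lee_fin mulr_ge0 ?t0 ?w0.
- exact/measurable_EFinP/measurable_funM.
- by move=> x /inO x1; rewrite mule_ge0 ?lee_fin ?w0// Q0.
apply: ge0_le_integral => //.
- move=> x /inO x1; apply: adde_ge0; first by rewrite lee_fin mulr_ge0 ?t0 ?w0.
  by rewrite mule_ge0 ?lee_fin ?w0// Q0.
- by apply: emeasurable_funD => //; exact/measurable_EFinP/measurable_funM.
- apply/measurable_EFinP/measurable_funM => //; exact: measurable_funM.
move=> x /inO x1; rewrite (mulrC (t x)) EFinM -ge0_muleDr ?lee_fin ?t0 ?Q0//.
rewrite (_ : q x * (x * w x) = w x * (x * q x)); last by ring.
by rewrite [leRHS]EFinM lee_wpmul2l ?lee_fin ?w0// tq.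
Qed.

End envelope.

(** * Splitting integrals over intervals, and elementary facts on (0,1) *)

Section itv_split.
Context (R : realType).
Local Notation leb := (@lebesgue_measure R).

Lemma ge0_integral_itv_split (a b c : R) (phi : R -> R) :
  a < b -> b <= c -> measurable_fun `]a, c[ phi ->
  (forall x, a < x < c -> 0 <= phi x) ->
  (\int[leb]_(x in `]a, c[) (phi x)%:E =
   \int[leb]_(x in `]a, b[) (phi x)%:E + \int[leb]_(x in `]b, c[) (phi x)%:E)%E.
Proof.
move=> ab; rewrite le_eqVlt => /predU1P[<- _ _|bc mphi phi0].
  by rewrite set_itvoo0 integral_set0 adde0.
have E : `]a, c[%classic = `]a, b[%classic `|` `[b, c[%classic :> set R.
  by rewrite -itv_bndbnd_setU// bnd_simp// ltW.
have mE : measurable_fun `]a, c[ (EFin \o phi) by exact/measurable_EFinP.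
have phiE x : `]a, c[%classic x -> (0 <= (phi x)%:E)%E.
  by rewrite /= in_itv/= lee_fin; exact: phi0.
rewrite [in LHS]E ge0_integral_setU//=.
- congr (_ + _)%E; rewrite -integral_itv_obnd_cbnd//.
  by apply: measurable_funS mE => //; apply: subset_itvr; rewrite bnd_simp ltW.
- by move: mE; rewrite E.
- by move: phiE; rewrite E.
- apply/disj_setPS => s [/=]; rewrite !in_itv/= => /andP[_ h] /andP[h' _].
  by have := lt_le_trans h h'; rewrite ltxx.
Qed.

End itv_split.

Lemma O01_lt (R : realType) (x : R) : O01 x -> 0 < x < 1.
Proof. by rewrite /O01 /= in_itv. Qed.

Lemma lt_O01 (R : realType) (x : R) : 0 < x < 1 -> O01 x.
Proof. by rewrite /O01 /= in_itv. Qed.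

Lemma measurable_invXn (R : realType) n :
  measurable_fun (@O01 R) (fun y : R => (y ^+ n)^-1).
Proof.
apply: (@measurable_funS _ _ _ _ (`]0, +oo[%classic : set R)) => //.
  by move=> x /O01_lt /andP[x0 _]; rewrite /= in_itv/= x0.
apply: open_continuous_measurable_fun; first exact: interval_open.
move=> x /set_mem /=; rewrite in_itv/= andbT => x0.
apply: cvgV; first by rewrite expf_neq0// gt_eqF.
exact: exprn_continuous.
Qed.

(** * Regular marginals: the density [g] and the rows of the adversarial structure *)

Section regular_marginal.
Context (R : realType) (f : R -> R).
Local Notation leb := (@lebesgue_measure R).
Hypothesis mf : measurable_fun (@O01 R) f.
Hypothesis f0 : forall x, 0 < x < 1 -> 0 <= f x.
Hypothesis fint : (\int[leb]_(x in O01) (f x)%:E < +oo)%E.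
Hypothesis reg : forall x y, 0 < x -> x <= y -> y < 1 ->
  x ^+ 2 * f x <= y ^+ 2 * f y.

Let h (s : R) := s ^+ 2 * f s.
Let G (x : R) := Rintegral leb `]0, x[ h.
Local Notation g := (gdens f).

Let gE y : g y = y * f y - G y / y ^+ 2. Proof. by []. Qed.

Let mO : measurable (@O01 R). Proof. exact: measurable_itv. Qed.

Let sub01 (a b : R) : 0 <= a -> b <= 1 -> `]a, b[ `<=` @O01 R.
Proof.
move=> a0 b1 x /=; rewrite in_itv/= => /andP[ax xb]; apply: lt_O01.
by rewrite (le_lt_trans a0 ax) (lt_le_trans xb b1).
Qed.

Let m01 (a b : R) (phi : R -> R) : 0 <= a -> b <= 1 ->
  measurable_fun (@O01 R) phi -> measurable_fun `]a, b[ phi.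
Proof. by move=> a0 b1; apply: measurable_funS => //; exact: sub01. Qed.

Let in01 (a b x : R) : 0 <= a -> b <= 1 -> a < x < b -> 0 < x < 1.
Proof.
by move=> a0 b1 /andP[ax xb]; rewrite (le_lt_trans a0 ax) (lt_le_trans xb b1).
Qed.

Let mh : measurable_fun (@O01 R) h.
Proof. by apply: measurable_funM => //; exact: measurable_funTS. Qed.

Let h0 x : 0 < x < 1 -> 0 <= h x.
Proof. by move=> x01; rewrite mulr_ge0 ?sqr_ge0 ?f0. Qed.

Let fin_le (phi : R -> R) (a b : R) : 0 <= a -> b <= 1 ->
  measurable_fun (@O01 R) phi -> (forall x, 0 < x < 1 -> 0 <= phi x <= f x) ->
  (\int[leb]_(x in `]a, b[) (phi x)%:E)%E \is a fin_num.
Proof.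
move=> a0 b1 mphi phif.
have p0 x : `]a, b[%classic x -> 0 <= phi x <= f x.
  by rewrite /= in_itv/= => /(in01 a0 b1); exact: phif.
rewrite ge0_fin_numE; last first.
  by apply: integral_ge0 => x /p0 /andP[]; rewrite lee_fin.
apply: le_lt_trans fint.
apply: (@le_trans _ _ (\int[leb]_(x in `]a, b[) (f x)%:E)%E).
  apply: ge0_le_integral => //.
  - by move=> x /p0 /andP[]; rewrite lee_fin.
  - by apply/measurable_EFinP; apply: m01.
  - by apply/measurable_EFinP; apply: m01.
  - by move=> x /p0 /andP[_]; rewrite lee_fin.
apply: ge0_subset_integral => //.
- exact/measurable_EFinP.
- exact: sub01.
Qed.

Let h_le_f x : 0 < x < 1 -> 0 <= h x <= f x.
Proof.
move=> x01; rewrite h0//= ler_piMl ?f0//.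
by case/andP: x01 => /ltW x0 /ltW x1; exact: exprn_ile1.
Qed.

Lemma integral_h (x : R) : x <= 1 ->
  (\int[leb]_(s in `]0%R, x[) (s ^+ 2 * f s)%:E = (G x)%:E)%E.
Proof. by move=> x1; rewrite /G /Rintegral fineK// fin_le. Qed.

Let G0 x : x <= 1 -> 0 <= G x.
Proof.
move=> x1; rewrite -lee_fin -integral_h//; apply: integral_ge0 => s /=.
by rewrite in_itv/= => /(in01 (lexx 0) x1) s1; rewrite lee_fin h0.
Qed.

(** By monotonicity [h] is at most [h x] on (0, x). Divided by x^2, this bound is the nonnegativity
    of [g]. *)
Let G_le x : 0 < x < 1 -> G x <= x * h x.
Proof.
move=> /andP[x0 x1]; rewrite -lee_fin -integral_h; last exact: ltW.
apply: (@le_trans _ _ (\int[leb]_(s in `]0%R, x[) (cst (h x)%:E) s)%E).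
  apply: ge0_le_integral => //.
  - by move=> s /=; rewrite in_itv/= => /(in01 (lexx 0) (ltW x1)) /h0.
  - by apply/measurable_EFinP; exact: m01 (lexx 0) (ltW x1) mh.
  - by move=> s /=; rewrite in_itv/= => /andP[s0 /ltW sx]; rewrite lee_fin reg.
rewrite integral_cst//= lebesgue_measure_itv/= lte_fin x0 -EFinB -EFinM.
by rewrite subr0 mulrC.
Qed.

Let G_split s x : 0 < s -> s <= x -> x <= 1 ->
  ((G x)%:E = (G s)%:E + \int[leb]_(y in `]s, x[) (h y)%:E)%E.
Proof.
move=> s0 sx x1; rewrite -!integral_h//; last exact: le_trans x1.
apply: ge0_integral_itv_split => //; first exact: m01.
by move=> y /(in01 (lexx 0) x1); exact: h0.
Qed.

(** By monotonicity [h] is at least [h s] on (s, 1). This serves the virtual-value bound against a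
    rival with value 1. *)
Lemma G1_ge s : 0 < s < 1 -> G s + h s * (1 - s) <= G 1.
Proof.
move=> /andP[s0 s1]; rewrite -lee_fin (G_split s0 (ltW s1))// EFinD leeD2l//.
apply: (@le_trans _ _ (\int[leb]_(y in `]s, 1%R[) (cst (h s)%:E) y)%E).
  by rewrite integral_cst//= lebesgue_measure_itv/= lte_fin s1 -EFinB -EFinM.
apply: ge0_le_integral => //.
- by move=> y _; rewrite lee_fin h0// s0.
- by apply/measurable_EFinP; exact: m01 (ltW s0) (lexx 1) mh.
- by move=> y /=; rewrite in_itv/= => /andP[/ltW sy y1]; rewrite lee_fin reg.
Qed.

Let mG : measurable_fun (@O01 R) G.
Proof.
have := @measurable_primitive R 1 h mh h0 => mG.
exact: (measurableT_comp (fine_measurable measurableT) mG).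
Qed.

Lemma measurable_gdens : measurable_fun (@O01 R) g.
Proof.
apply: measurable_funB; first exact: measurable_funM.
exact: measurable_funM mG (@measurable_invXn R 2).
Qed.

Lemma gdens_ge0 x : 0 < x < 1 -> 0 <= g x.
Proof.
move=> x01; have /andP[x0 x1] := x01.
rewrite gE subr_ge0 ler_pdivrMr ?exprn_gt0// (le_trans (G_le x01))//.
by rewrite (_ : x * f x * x ^+ 2 = x * h x)// /h; ring.
Qed.

Let xf_le x : 0 < x < 1 -> 0 <= x * f x <= f x.
Proof.
move=> x01; have /andP[x0 x1] := x01.
apply/andP; split; first by rewrite mulr_ge0 ?f0// ltW.
by rewrite ler_piMl ?f0// ltW.
Qed.

(** By Tonelli the integral of G(y) / y^2 over (0, x) equals that of h(s) (1/s - 1/x). Since h(s) /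
    s = s f(s), subtracting it from the integral of y f(y) leaves G(x) / x. *)
Lemma integral_gdens x : 0 < x <= 1 ->
  (\int[leb]_(y in `]0%R, x[) (g y)%:E = (G x / x)%:E)%E.
Proof.
move=> /andP[x0 x1].
have i01 y : `]0, x[%classic y -> 0 < y < 1.
  by rewrite /= in_itv/= => /(in01 (lexx 0) x1).
pose B := (\int[leb]_(y in `]0%R, x[) (y * f y)%:E)%E.
have Bfin : B \is a fin_num by apply: fin_le => //; exact: measurable_funM.
pose A := (\int[leb]_(y in `]0%R, x[) (G y / y ^+ 2)%:E)%E.
(* The identities are stated with sums rather than differences until [A] is known to be finite. *)
have gA : (\int[leb]_(y in `]0%R, x[) (g y)%:E + A = B)%E.
  rewrite -ge0_integralD//.
  - by apply: eq_integral => y _; rewrite -EFinD gE subrK.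
  - by move=> y /i01 /gdens_ge0; rewrite lee_fin.
  - by apply/measurable_EFinP; exact: m01 (lexx 0) x1 measurable_gdens.
  - move=> y /i01 /andP[y0 y1]; rewrite lee_fin.
    by rewrite divr_ge0 ?sqr_ge0// G0// ltW.
  - by apply/measurable_EFinP; apply: (m01 (lexx 0) x1); exact: measurable_funM mG (@measurable_invXn R 2).
have AG : (A + (G x / x)%:E = B)%E.
  have -> : A = (\int[leb]_(s in `]0%R, x[) (h s * (s^-1 - x^-1))%:E)%E.
    transitivity (\int[leb]_(y in `]0%R, x[) (((y ^+ 2)^-1)%:E *
        \int[leb]_(s in `]0%R, y[) (h s)%:E))%E.
      apply: eq_integral => y /set_mem /i01 /andP[y0 y1].
      by rewrite integral_h ?ltW// -EFinM mulrC.
    rewrite tonelli_triangle.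
    - apply: eq_integral => s /set_mem /=; rewrite in_itv/= => /andP[s0 sx].
      by rewrite integral_invsq// ?ltW.
    - exact: m01 (lexx 0) x1 (@measurable_invXn R 2).
    - exact: m01 (lexx 0) x1 mh.
    - by move=> y _; rewrite invr_ge0 sqr_ge0.
    - by move=> y /(in01 (lexx 0) x1); exact: h0.
  have -> : ((G x / x)%:E = \int[leb]_(s in `]0%R, x[) (h s / x)%:E)%E.
    rewrite mulrC EFinM -integral_h// -ge0_integralZl//.
    - by apply: eq_integral => s _; rewrite -EFinM mulrC.
    - by apply/measurable_EFinP; apply: m01.
    - by move=> s /i01 /h0; rewrite lee_fin.
    - by rewrite lee_fin invr_ge0 ltW.
  rewrite -ge0_integralD//.
  - apply: eq_integral => s /set_mem /i01 /andP[s0 s1].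
    by rewrite -EFinD /h; congr EFin; field; rewrite !gt_eqF.
  - move=> s /[dup] /i01 s01 /=; rewrite in_itv/= => /andP[s0 sx].
    by rewrite lee_fin mulr_ge0 ?h0// subr_ge0 lef_pV2 ?posrE ?ltW.
  - apply/measurable_EFinP; apply: (m01 (lexx 0) x1).
    by apply: measurable_funM => //; exact: measurable_funB (@measurable_invXn R 1) _.
  - by move=> s /i01 /h0 hs; rewrite lee_fin divr_ge0// ltW.
  - by apply/measurable_EFinP; apply: (m01 (lexx 0) x1); apply: measurable_funM.
(* [AG] gives [A <= B] with [B] finite, so [A] can be cancelled between [gA] and [AG]. *)
have Afin : A \is a fin_num.
  have A0 : (0 <= A)%E.
    apply: integral_ge0 => y /i01 /andP[y0 y1].
    rewrite lee_fin.
    by rewrite divr_ge0 ?sqr_ge0// G0// ltW.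
  rewrite ge0_fin_numE//; apply: (@le_lt_trans _ _ B).
    by rewrite -AG leeDl// lee_fin divr_ge0 ?G0// ltW.
  by rewrite -ge0_fin_numE// -AG adde_ge0// lee_fin divr_ge0 ?G0// ltW.
by rewrite -[LHS](addeK _ Afin) gA -AG addeAC subee// add0e.
Qed.

(** Row [x] of the interior density of the adversarial structure: [x] is the rival's value, [y] the
    bidder's own. *)
Let w (x y : R) := g (Order.min x y) / (Order.max x y) ^+ 2.

Lemma measurable_row x : 0 < x < 1 -> measurable_fun (@O01 R) (w x).
Proof.
move=> x01; apply: measurable_funM.
  apply: (@measurable_comp _ _ _ _ _ _ (@O01 R)) => //.
  - move=> _ [y /O01_lt y01 <-]; apply: lt_O01.
    by rewrite /Order.min; case: ifP.
  - exact: measurable_gdens.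
  - exact: measurable_funTS (measurable_minr _ _).
apply: (@measurable_comp _ _ _ _ _ _ (@O01 R) (fun y : R => (y ^+ 2)^-1)) => //.
- move=> _ [y /O01_lt y01 <-]; apply: lt_O01.
  by rewrite /Order.max; case: ifP.
- exact: measurable_invXn.
- exact: measurable_funTS (measurable_maxr _ _).
Qed.

Lemma row_ge0 x y : 0 < x < 1 -> 0 < y < 1 -> 0 <= w x y.
Proof.
move=> x01 y01; rewrite divr_ge0 ?sqr_ge0// gdens_ge0//.
by rewrite /Order.min; case: ifP.
Qed.

(** To the right of [x] the minimum is [x], so the row is g(x) / y^2. *)
Let row_above x s : 0 < x < 1 -> x <= s -> s <= 1 ->
  (\int[leb]_(y in `]s, 1%R[) (w x y)%:E = (g x * (s^-1 - 1))%:E)%E.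
Proof.
move=> x01 xs s1; have /andP[x0 x1] := x01.
have s0 : 0 < s by exact: lt_le_trans xs.
rewrite -[in RHS]invr1 EFinM -integral_invsq// -ge0_integralZl//.
- apply: eq_integral => y /set_mem /=; rewrite in_itv/= => /andP[sy _].
  by rewrite /w min_l ?max_r ?(le_trans xs) ?ltW.
- by apply/measurable_EFinP; exact: m01 (ltW s0) (lexx 1) (@measurable_invXn R 2).
- by move=> y _; rewrite lee_fin invr_ge0 sqr_ge0.
- by rewrite lee_fin gdens_ge0.
Qed.

(** To the left of [x] minimum and maximum trade places, so the row is g(y) / x^2. *)
Let row_below x s : 0 < x < 1 -> 0 <= s ->
  (\int[leb]_(y in `]s, x[) (w x y)%:E =
   (x ^- 2)%:E * \int[leb]_(y in `]s, x[) (g y)%:E)%E.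
Proof.
move=> /andP[x0 x1] s0.
rewrite -ge0_integralZl//.
- apply: eq_integral => y /set_mem /=; rewrite in_itv/= => /andP[_ /ltW yx].
  by rewrite /w min_r// max_l// mulrC.
- by apply/measurable_EFinP; exact: m01 s0 (ltW x1) measurable_gdens.
- by move=> y /=; rewrite in_itv/= lee_fin => /(in01 s0 (ltW x1)) /gdens_ge0.
- by rewrite lee_fin invr_ge0 sqr_ge0.
Qed.

(** Splitting at [x] gives G(x) / x^3 + g(x) (1/x - 1), and G(x) / x^3 = f(x) - g(x) / x. The mass
    g(x) missing from f(x) sits on the boundary segment. *)
Lemma integral_row x : 0 < x < 1 ->
  (\int[leb]_(y in O01) (w x y)%:E = (f x - g x)%:E)%E.
Proof.
move=> x01; have /andP[x0 x1] := x01.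
rewrite (@ge0_integral_itv_split R 0 x 1)//; last 3 first.
- exact: ltW.
- exact: measurable_row.
- by move=> y; exact: row_ge0.
rewrite row_above ?lexx ?(ltW x1)// row_below// integral_gdens ?x0 ?ltW//.
rewrite -EFinM -EFinD gE; congr EFin; field; rewrite gt_eqF//.
Qed.

Let integral_gdens_between s x : 0 < s -> s < x -> x <= 1 ->
  (\int[leb]_(y in `]s, x[) (g y)%:E = (G x / x - G s / s)%:E)%E.
Proof.
move=> s0 sx x1.
have := @ge0_integral_itv_split R 0 s x g s0 (ltW sx).
rewrite !integral_gdens ?s0 ?(lt_trans s0 sx) ?x1 ?(le_trans (ltW sx))//.
move=> /(_ (m01 (lexx 0) x1 measurable_gdens)) E; rewrite EFinB E.
  by rewrite addeAC subee// add0e.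
by move=> y /(in01 (lexx 0) x1); exact: gdens_ge0.
Qed.

(** The right-hand side is the mass of own values above [s] in row [x], the term g(x) being the
    boundary mass at 1. Both sides equal g(x) / s when x <= s; when s < x they differ by (h(x) -
    h(s)) / x^2, nonnegative by regularity. *)
Lemma row_virtual_le x s : 0 < x < 1 -> 0 < s < 1 ->
  ((s * w x s)%:E <= \int[leb]_(y in `]s, 1%R[) (w x y)%:E + (g x)%:E)%E.
Proof.
move=> x01 s01; have /andP[x0 x1] := x01; have /andP[s0 s1] := s01.
have [xs|sx] := leP x s.
  rewrite row_above ?(ltW s1)// -EFinD lee_fin /w min_l// max_r//.
  rewrite (_ : s * _ = g x * (s^-1 - 1) + g x)//.
  by field; rewrite gt_eqF//.
rewrite (@ge0_integral_itv_split R s x 1)//; last 3 first.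
- exact: ltW.
- exact: m01 (ltW s0) (lexx 1) (measurable_row x01).
- by move=> y /(in01 (ltW s0) (lexx 1)); exact: row_ge0.
rewrite row_above ?lexx ?(ltW x1)// row_below ?(ltW s0)//.
rewrite integral_gdens_between ?(ltW x1)// -EFinM -!EFinD lee_fin.
rewrite /w min_r ?(ltW sx)// max_l ?(ltW sx)//.
have hE y : 0 < y -> y * g y + G y / y = h y.
  by move=> y0; rewrite gE /h; field; rewrite gt_eqF//.
have hsx : h s <= h x by exact: reg (ltW sx) x1.
rewrite -subr_ge0.
rewrite (_ : _ - _ = (h x - h s) / x ^+ 2); first by rewrite divr_ge0 ?subr_ge0 ?sqr_ge0.
rewrite -!hE//; field; by rewrite !gt_eqF.
Qed.

(** With r = G(s) / s and d = h(s) - r >= 0, the claim reduces to h(s) <= p1 + d / s. [G1_ge] gives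
    p1 >= h(s) - s d, and s d <= d <= d / s. *)
Lemma gdens_virtual_le p1 s : G 1 <= p1 -> 0 < s < 1 ->
  ((s * g s)%:E <= \int[leb]_(y in `]s, 1%R[) (g y)%:E
                    + (p1 - G 1)%:E + (g s)%:E)%E.
Proof.
move=> Gp1 s01; have /andP[s0 s1] := s01.
rewrite integral_gdens_between// -!EFinD lee_fin divr1.
have := G1_ge s01; have := G_le s01; have hs := h0 s01.
have -> : s * g s = h s - G s / s.
  by rewrite gE /h; field; rewrite gt_eqF//.
have -> : g s = (h s - G s / s) / s.
  by rewrite gE /h; field; rewrite gt_eqF//.
have [r ->] : exists r, G s = s * r by exists (G s / s); field; rewrite gt_eqF//.
rewrite (_ : s * r / s = r); last by field; rewrite gt_eqF.
rewrite ler_pM2l// => rh G1h.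
set d := h s - r.
have d0 : 0 <= d by rewrite subr_ge0.
have ds : d <= d / s by rewrite ler_pdivlMr// ler_piMr// ltW.
have Gd : s * r + h s * (1 - s) <= p1 by exact: le_trans Gp1.
have sd : s * d <= d by rewrite ler_piMl// ltW.
move: (d / s) ds => z; rewrite /d in sd * => dz.
have : h s - p1 <= s * (h s - r) by lra.
lra.
Qed.

End regular_marginal.

(** * A single bidder facing a fixed rival value *)

Section single_bidder.
Context (R : realType).
Local Notation leb := (@lebesgue_measure R).
Variables q t : R -> R.
Hypothesis q01 : forall x, 0 <= x <= 1 -> 0 <= q x <= 1.
Hypothesis ic : forall x y, 0 <= x <= 1 -> 0 <= y <= 1 ->
  x * q y - t y <= x * q x - t x.
Hypothesis t0 : t 0 = 0.

Let zero01 : 0 <= (0 : R) <= 1. Proof. by rewrite lexx ler01. Qed.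
Let one01 : 0 <= (1 : R) <= 1. Proof. by rewrite lexx ler01. Qed.

(** Adding the two incentive constraints between [x] and [y] gives (y - x) (q y - q x) >= 0. *)
Lemma ic_monotone x y : 0 <= x -> x <= y -> y <= 1 -> q x <= q y.
Proof.
move=> x0; rewrite le_eqVlt => /predU1P[->//|xy] y1.
have x01 : 0 <= x <= 1 by rewrite x0 (le_trans (ltW xy)).
have y01 : 0 <= y <= 1 by rewrite y1 (le_trans x0 (ltW xy)).
have yx0 : 0 < y - x by rewrite subr_gt0.
rewrite -subr_ge0 -(pmulr_rge0 _ yx0).
have := ic x01 y01; have := ic y01 x01; lra.
Qed.

(** The lowest type pays nothing and would gain by imitating a type with a negative payment. *)
Lemma ic_payment_ge0 x : 0 <= x <= 1 -> 0 <= t x.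
Proof.
move=> x01; have := ic zero01 x01; rewrite t0 !mul0r; lra.
Qed.

(** The hypotheses constrain [q] on [0,1] only; projecting the argument onto [0,1] yields a function
    monotone on the whole line. *)
Let clamp (x : R) := Num.max 0 (Num.min x 1).

Let clamp01 x : 0 <= clamp x <= 1.
Proof. by rewrite /clamp le_max lexx/= ge_max ler01 ge_min lexx orbT. Qed.

Let clampE x : 0 <= x <= 1 -> clamp x = x.
Proof. by move=> /andP[x0 x1]; rewrite /clamp min_l// max_r. Qed.

Let clamp_homo : {homo (q \o clamp) : x y / x <= y}.
Proof.
move=> x y xy /=; have /andP[cx0 _] := clamp01 x; have /andP[_ cy1] := clamp01 y.
apply: ic_monotone => //; rewrite /clamp ge_max !le_max lexx/=.
by rewrite le_min !ge_min xy lexx !orbT.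
Qed.

Let O01W (x : R) : O01 x -> 0 <= x <= 1.
Proof. by move=> /O01_lt /andP[/ltW -> /ltW]. Qed.

Lemma ic_measurable : measurable_fun (@O01 R) q.
Proof.
apply: (@eq_measurable_fun _ _ _ _ _ (q \o clamp)).
  by move=> x /set_mem /O01W /clampE /= ->.
by apply: nondecreasing_measurable => //; exact: measurable_itv.
Qed.

(** The utility u(x) = x q(x) - t(x) vanishes at 0, and incentive compatibility makes q(a) a
    subgradient of it: q(a) (b - a) <= u(b) - u(a). So [envelope_le] applies. *)
Lemma ic_envelope x : 0 <= x <= 1 ->
  ((t x)%:E + \int[leb]_(s in `]0%R, x[) (q s)%:E <= (x * q x)%:E)%E.
Proof.
move=> x01; have /andP[x0 x1] := x01.
have : (\int[leb]_(s in `]0%R, x[) ((q \o clamp) s)%:E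
    <= ((x * q x - t x) - (0 * q 0 - t 0))%:E)%E.
  apply: (@envelope_le _ _ (fun x => x * q x - t x)) => //.
  - by move=> a; apply: q01.
  - move=> a b a0 ab bx.
    have a01 : 0 <= a <= 1 by rewrite a0 (le_trans ab)// (le_trans bx).
    have b01 : 0 <= b <= 1 by rewrite (le_trans a0 ab) (le_trans bx).
    by rewrite /= clampE//; have := ic b01 a01; lra.
rewrite t0 mul0r subr0 subr0 EFinB leeBrDr// addeC; apply: le_trans.
rewrite leeD2l//; set I := (X in (_ <= X)%E).
suff -> : (\int[leb]_(s in `]0%R, x[) (q s)%:E = I)%E by [].
apply: eq_integral => s /set_mem; rewrite /= in_itv/= => /andP[s0 sx].
by rewrite /= clampE// (ltW s0) ltW// (lt_le_trans sx).
Qed.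

Let q0 x : 0 < x < 1 -> 0 <= q x.
Proof. by move=> /lt_O01 /O01W /q01 /andP[]. Qed.

Let Iq := (\int[leb]_(s in O01) (q s)%:E)%E.

(** Since [t 1 >= 0], the envelope at 1 bounds [Iq] by [q 1]. *)
Let Iq_fin : Iq \is a fin_num.
Proof.
rewrite ge0_fin_numE; last first.
  by apply: integral_ge0 => x /O01_lt /q0; rewrite lee_fin.
apply: (@le_lt_trans _ _ ((t 1)%:E + Iq)%E).
  by rewrite leeDr// lee_fin ic_payment_ge0.
apply: le_lt_trans (ltry (q 1)).
by have := ic_envelope one01; rewrite mul1r.
Qed.

(* The right-hand side is what a bidder could be charged if only the top value
   and the slack [r] of the virtual-value inequality contributed. *)
Lemma revenue_le_top_surplus (w r : R -> R) (c : R) :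
  measurable_fun (@O01 R) t ->
  measurable_fun (@O01 R) w -> (forall x, 0 < x < 1 -> 0 <= w x) ->
  (\int[leb]_(x in O01) (w x)%:E < +oo)%E ->
  measurable_fun (@O01 R) r -> (forall x, 0 < x < 1 -> 0 <= r x) -> 0 <= c ->
  (forall s, 0 < s < 1 ->
    ((s * w s)%:E <= \int[leb]_(x in `]s, 1%R[) (w x)%:E + c%:E + (r s)%:E)%E) ->
  (\int[leb]_(x in O01) (t x * w x)%:E + (c * t 1)%:E
   <= (c * q 1)%:E + \int[leb]_(x in O01) (q x * r x)%:E)%E.
Proof.
move=> mt mw w0 wint mr r0 c0 vv.
have mO : measurable (@O01 R) by exact: measurable_itv.
have mq := ic_measurable.
have mW := measurable_coprimitive mw w0.
have W0 s : O01 s -> (0 <= \int[leb]_(x in `]s, 1%R[) (w x)%:E)%E.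
  move=> /O01_lt /andP[s0 _]; apply: integral_ge0 => x /=.
  by rewrite in_itv/= lee_fin => /andP[sx x1]; rewrite w0// x1 (lt_trans s0).
pose T := (\int[leb]_(s in O01) ((q s)%:E * \int[leb]_(x in `]s, 1%R[) (w x)%:E))%E.
have T0 : (0 <= T)%E.
  by apply: integral_ge0 => s sO; rewrite mule_ge0 ?lee_fin ?q0 ?O01_lt// W0.
have mqE : measurable_fun (@O01 R) (EFin \o q) by exact/measurable_EFinP.
have mwE : measurable_fun (@O01 R) (EFin \o w) by exact/measurable_EFinP.
have TM : measurable_fun (@O01 R)
    (fun s => (q s)%:E * \int[leb]_(x in `]s, 1%R[) (w x)%:E)%E.
  exact: emeasurable_funM.
(* Finiteness is what allows [T] to be cancelled below; each tail mass is at most the total mass of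
   [w]. *)
have Tfin : T \is a fin_num.
  rewrite ge0_fin_numE//.
  set W := (\int[leb]_(x in O01) (w x)%:E)%E in wint.
  have W_ge0 : (0 <= W)%E.
    by apply: integral_ge0 => x /O01_lt /w0; rewrite lee_fin.
  have Wfin : W \is a fin_num by rewrite ge0_fin_numE.
  apply: (@le_lt_trans _ _ (Iq * W)%E); last by rewrite ltey_eq fin_numM.
  have <- : (\int[leb]_(s in O01) ((q s)%:E * W) = Iq * W)%E.
    by apply: ge0_integralZr => // x /O01_lt /q0; rewrite lee_fin.
  apply: ge0_le_integral => //.
  - by move=> s sO; rewrite mule_ge0 ?lee_fin ?q0 ?O01_lt// W0.
  - by apply: emeasurable_funM => //; exact: measurable_cst.
  - move=> s sO; rewrite lee_wpmul2l ?lee_fin ?q0 ?O01_lt//.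
    apply: ge0_subset_integral => //.
    move=> x /=; rewrite in_itv/= => /andP[sx x1]; apply: lt_O01.
    by have /andP[s0 _] := O01_lt sO; rewrite x1 (lt_trans s0).
have vs : (\int[leb]_(x in O01) (t x * w x)%:E + T
    <= \int[leb]_(x in O01) (q x * (x * w x))%:E)%E.
  apply: payment_le_virtual_surplus => //.
    by move=> x /lt_O01 /O01W; exact: ic_payment_ge0.
  by move=> x /lt_O01 /O01W; exact: ic_envelope.
have mqr : measurable_fun (@O01 R) (fun x => (q x * r x)%:E).
  exact/measurable_EFinP/measurable_funM.
have qr0 x : O01 x -> (0 <= (q x * r x)%:E)%E.
  by move=> /O01_lt x01; rewrite lee_fin mulr_ge0 ?q0 ?r0.
have cIq : (\int[leb]_(s in O01) (c%:E * (q s)%:E) = c%:E * Iq)%E.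
  by rewrite ge0_integralZl// => x /O01_lt /q0; rewrite lee_fin.
have mcq : measurable_fun (@O01 R) (fun s => (c%:E * (q s)%:E)%E).
  exact: measurable_funeM.
have cq0 s : O01 s -> (0 <= c%:E * (q s)%:E)%E.
  by move=> /O01_lt /q0 qs; rewrite mule_ge0 ?lee_fin.
have qw : (\int[leb]_(x in O01) (q x * (x * w x))%:E
    <= T + c%:E * Iq + \int[leb]_(x in O01) (q x * r x)%:E)%E.
  rewrite -cIq -ge0_integralD//; last first.
    by move=> s sO; rewrite mule_ge0 ?lee_fin ?q0 ?O01_lt// W0.
  rewrite -ge0_integralD//; last 2 first.
  - move=> s sO; rewrite adde_ge0 ?cq0//.
    by rewrite mule_ge0 ?lee_fin ?q0 ?O01_lt// W0.
  - exact: emeasurable_funD.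
  apply: ge0_le_integral => //.
  - move=> x /O01_lt x01; rewrite lee_fin !mulr_ge0 ?q0 ?w0//.
    by case/andP: x01 => /ltW.
  - by apply/measurable_EFinP/measurable_funM => //; exact: measurable_funM.
  - by apply: emeasurable_funD => //; exact: emeasurable_funD.
  move=> x xO; have x01 := O01_lt xO.
  rewrite EFinM; apply: le_trans (lee_wpmul2l _ (vv x x01)) _.
    by rewrite lee_fin q0.
  have Wx := W0 _ xO.
  rewrite ge0_muleDr ?lee_fin ?r0//; last by rewrite adde_ge0 ?lee_fin.
  rewrite ge0_muleDr ?lee_fin//.
  by rewrite EFinM [in leRHS](muleC c%:E).
(* [T] cancels between the payment bound [vs] and the virtual-value bound [qw]. *)
have tw : (\int[leb]_(x in O01) (t x * w x)%:E
    <= c%:E * Iq + \int[leb]_(x in O01) (q x * r x)%:E)%E.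
  rewrite -(leeD2rE _ _ Tfin) (le_trans vs)// (le_trans qw)//.
  by rewrite -addeA addeC lexx.
(* The remaining [c * Iq] is absorbed together with the atom's payment [c * t 1], because
   [t 1 + Iq <= q 1] by the envelope at 1. *)
apply: le_trans (leeD2r _ tw) _; rewrite addeAC leeD2r//.
rewrite !EFinM -muleDr ?fin_num_adde_defl//.
rewrite lee_wpmul2l ?lee_fin// addeC.
by have := ic_envelope one01; rewrite mul1r.
Qed.

End single_bidder.

(** * Existence of measures with prescribed integrals *)

Section measure_existence.
Local Open Scope ereal_scope.

(** Measures are exposed only through their integrals of nonnegative functions, so that
    [sum_measure] can assemble them term by term. The density is extended by zero off [D]. *)
Lemma density_pushforward_measure d1 d2 (X : measurableType d1)
    (Y : measurableType d2) (R : realType) (mu : {measure set X -> \bar R})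
    (phi : X -> Y) (D : set X) (w : X -> R) :
  measurable_fun setT phi -> measurable D ->
  measurable_fun D w -> (forall x, D x -> (0 <= w x)%R) ->
  exists nu : {measure set Y -> \bar R}, forall F : Y -> \bar R,
    measurable_fun setT F -> (forall y, 0 <= F y) ->
    \int[nu]_y F y = \int[mu]_(x in D) (F (phi x) * (w x)%:E).
Proof.
move=> mphi mD mw w0.
have mw' : measurable_fun setT (w \_ D) by exact/(measurable_restrictT _ mD).
have w0' x : (0 <= (w \_ D) x)%R.
  by rewrite patchE; case: ifPn => // /set_mem; exact: w0.
exists (pushforward (density_measure mu mw' w0') phi) => F mF F0.
rewrite (ge0_integral_pushforward mphi)// preimage_setT ge0_integral_density_measure//.
- rewrite [RHS]integral_mkcond; apply: eq_integral => x _.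
  by rewrite !patchE; case: ifPn => // _; rewrite mule0.
- exact: measurableT_comp.
- by move=> x; exact: F0.
Unshelve. exact: mphi.
Qed.

Lemma scaled_dirac_measure d (T : measurableType d) (R : realType) (a : T) (c : R) :
  (0 <= c)%R ->
  exists nu : {measure set T -> \bar R}, forall F : T -> \bar R,
    measurable_fun setT F -> (forall y, 0 <= F y) ->
    \int[nu]_y F y = c%:E * F a.
Proof.
move=> c0; exists (mscale (NngNum c0) (\d_ a)) => F mF F0.
by rewrite ge0_integral_mscale// integral_dirac// diracT mul1e.
Qed.

Lemma sum_measure d (T : measurableType d) (R : realType)
    (nu1 nu2 : {measure set T -> \bar R}) (L1 L2 : (T -> \bar R) -> \bar R) :
  (forall F, measurable_fun setT F -> (forall y, 0 <= F y) -> \int[nu1]_y F y = L1 F) ->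
  (forall F, measurable_fun setT F -> (forall y, 0 <= F y) -> \int[nu2]_y F y = L2 F) ->
  exists nu : {measure set T -> \bar R}, forall F,
    measurable_fun setT F -> (forall y, 0 <= F y) ->
    \int[nu]_y F y = L1 F + L2 F.
Proof.
move=> H1 H2; exists (measure_add nu1 nu2) => F mF F0.
by rewrite ge0_integral_measure_add// H1// H2.
Qed.

(** Normalization does nothing at total mass 1; the Dirac mass at [x] is only the fallback value of
    [mnormalize]. *)
Lemma probability_of_measure d (T : measurableType d) (R : realType) (x : T)
    (nu : {measure set T -> \bar R}) : nu setT = 1 ->
  exists P : probability T R, forall A, P A = nu A.
Proof.
move=> nu1.
have E A : mnormalize nu (dirac x : probability T R) A = nu A.
  rewrite /mnormalize nu1 onee_eq0/=.
  by rewrite (_ : (1^-1 : R)%:E = 1%:E) ?mule1// invr1.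
by exists (mnormalize nu (dirac x)).
Qed.

Lemma integral_indicT d (T : measurableType d) (R : realType)
    (nu : {measure set T -> \bar R}) (A : set T) :
  measurable A -> \int[nu]_y (\1_A y)%:E = nu A.
Proof. by move=> mA; rewrite integral_indic// setIT. Qed.

End measure_existence.

(** * Integration against a marginal *)

Section marginal_integral.
Context (R : realType) (p0 p1 : R) (f : R -> R).
Local Notation leb := (@lebesgue_measure R).
Hypothesis p0_ge0 : 0 <= p0.
Hypothesis p1_ge0 : 0 <= p1.
Hypothesis mf : measurable_fun (@O01 R) f.
Hypothesis f0 : forall x, 0 < x < 1 -> 0 <= f x.

Let mO : measurable (@O01 R). Proof. exact: measurable_itv. Qed.

(** [phi] stands for either coordinate. The marginal is rebuilt as two atoms plus a density, and the
    pushforward of [P] agrees with it on measurable sets. *)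
Lemma integral_marginal (P : probability (R * R)%type R) (phi : R * R -> R) (F : R -> R) :
  measurable_fun setT phi ->
  (forall A, measurable A -> P (phi @^-1` A) = Fmeas p0 p1 f A) ->
  measurable_fun setT F -> (forall x, 0 <= F x) ->
  (\int[P]_v (F (phi v))%:E =
   (p0 * F 0 + p1 * F 1)%:E + \int[leb]_(x in O01) (F x * f x)%:E)%E.
Proof.
move=> mphi PF mF F0.
have [nu0 n0] := scaled_dirac_measure (0 : R) p0_ge0.
have [nu1 n1] := scaled_dirac_measure (1 : R) p1_ge0.
have f0' x : O01 x -> 0 <= f x by move=> /O01_lt /f0.
have [nuf nf] := @density_pushforward_measure _ _ _ R _ leb idfun _ _
  (@measurable_id _ R setT) mO mf f0'.
have [nu01 n01] := sum_measure n0 n1.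
have [nu n] := sum_measure n01 nf.
have mEF : measurable_fun setT (EFin \o F) by exact/measurable_EFinP.
transitivity (\int[pushforward P phi]_x (F x)%:E)%E.
  rewrite (ge0_integral_pushforward mphi)//.
  by move=> y _; rewrite lee_fin.
transitivity (\int[nu]_x (F x)%:E)%E; last first.
  by rewrite n.
apply: eq_measure_integral => A mA _.
transitivity (Fmeas p0 p1 f A); first exact: PF.
rewrite -integral_indicT// n; last 2 first.
- exact: measurableT_comp.
- by move=> y; rewrite lee_fin.
rewrite /Fmeas; congr (_ + _)%E.
rewrite integral_mkcondl; apply: eq_integral => x _.
by rewrite patchE indicE; case: ifPn => _; rewrite ?mul1e ?mul0e.
Qed.

End marginal_integral.

(** * The adversarial correlation structure and its marginals *)

Section correlation_structure.
Context (R : realType) (p0 p1 : R) (f : R -> R).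
Local Notation leb := (@lebesgue_measure R).
Hypothesis p0_ge0 : 0 <= p0.
Hypothesis mf : measurable_fun (@O01 R) f.
Hypothesis f0 : forall x, 0 < x < 1 -> 0 <= f x.
Hypothesis fint : (\int[leb]_(x in O01) (f x)%:E < +oo)%E.
Hypothesis reg : forall x y, 0 < x -> x <= y -> y < 1 ->
  x ^+ 2 * f x <= y ^+ 2 * f y.
Local Notation g := (gdens f).
Local Notation G1 := (Rintegral leb O01 (fun s => s ^+ 2 * f s)).
Hypothesis G1_le : G1 <= p1.

Let mO : measurable (@O01 R). Proof. exact: measurable_itv. Qed.
Let mOO : measurable (@O01 R `*` @O01 R). Proof. exact: measurableX. Qed.

Definition corr_dens (z : R * R) : R :=
  g (Order.min z.1 z.2) / (Order.max z.1 z.2) ^+ 2.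

Lemma corr_densC x y : corr_dens (x, y) = corr_dens (y, x).
Proof. by rewrite /corr_dens /= minC maxC. Qed.

Lemma corr_dens_ge0 z : (O01 `*` O01) z -> 0 <= corr_dens z.
Proof. by case: z => x y [/= /O01_lt x01 /O01_lt y01]; exact: row_ge0. Qed.

Lemma measurable_corr_dens : measurable_fun (O01 `*` O01) corr_dens.
Proof.
have mg : measurable_fun (@O01 R) g by exact: measurable_gdens.
have mV : measurable_fun (@O01 R) (fun y : R => (y ^+ 2)^-1).
  exact: measurable_invXn.
apply: measurable_funM.
  apply: (@measurable_comp _ _ _ _ _ _ (@O01 R)) => //.
    move=> _ [[x y] [/= xO yO] <-] /=.
    by rewrite /Order.min; case: ifP.
  by apply: measurable_funTS; exact: measurable_minr.
apply: (@measurable_comp _ _ _ _ _ _ (@O01 R) (fun y : R => (y ^+ 2)^-1)) => //.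
  move=> _ [[x y] [/= xO yO] <-] /=.
  by rewrite /Order.max; case: ifP.
by apply: measurable_funTS; exact: measurable_maxr.
Qed.

Let g0 x : O01 x -> 0 <= g x.
Proof. by move=> /O01_lt; exact: gdens_ge0. Qed.

Let mg : measurable_fun (@O01 R) g. Proof. exact: measurable_gdens. Qed.

(** Integral against the adversarial structure, piece by piece; on indicators it is [pistar_fun]. *)
Definition corr_integral (F : R * R -> \bar R) : \bar R :=
  (p0%:E * F (0, 0)%R + \int[leb \x leb]_(z in O01 `*` O01) (F z * (corr_dens z)%:E)
   + \int[leb]_(x in O01) (F (1, x)%R * (g x)%:E)
   + \int[leb]_(x in O01) (F (x, 1)%R * (g x)%:E)
   + (p1 - G1)%:E * F (1, 1)%R)%E.

Lemma corr_measure_exists : exists nu : {measure set (R * R) -> \bar R},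
  forall F, measurable_fun setT F -> (forall z, 0 <= F z)%E ->
  (\int[nu]_z F z = corr_integral F)%E.
Proof.
have [nu0 n0] := scaled_dirac_measure ((0, 0) : R * R) p0_ge0.
have [nu1 n1] := @density_pushforward_measure _ _ _ (R * R)%type _
  (leb \x leb)%E idfun _ _ (@measurable_id _ (R * R)%type setT)
  mOO measurable_corr_dens corr_dens_ge0.
have [nu2 n2] := @density_pushforward_measure _ _ _ (R * R)%type _ leb
  (pair 1) _ _ (@pair1_measurable _ _ R R 1) mO mg g0.
have [nu3 n3] := @density_pushforward_measure _ _ _ (R * R)%type _ leb
  (pair^~ 1) _ _ (@pair2_measurable _ _ R R 1) mO mg g0.
have m0 : 0 <= p1 - G1 by rewrite subr_ge0.
have [nu4 n4] := scaled_dirac_measure ((1, 1) : R * R) m0.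
have [a na] := sum_measure n0 n1.
have [b nb] := sum_measure na n2.
have [c nc] := sum_measure nb n3.
exact: sum_measure nc n4.
Qed.

Lemma integral_corr_fst (F : R -> R) :
  measurable_fun setT F -> (forall x, 0 <= F x) ->
  (\int[leb \x leb]_(z in O01 `*` O01) ((F z.1)%:E * (corr_dens z)%:E) =
   \int[leb]_(x in O01) (F x * (f x - g x))%:E)%E.
Proof.
move=> mF F0; rewrite tonelli_on1//; last 2 first.
- apply: emeasurable_funM; apply/measurable_EFinP.
    by apply: measurable_funTS; exact: measurableT_comp.
  exact: measurable_corr_dens.
- by move=> z zO; rewrite -EFinM lee_fin mulr_ge0 ?corr_dens_ge0.
apply: eq_integral => x /set_mem /O01_lt x01 /=.
rewrite EFinM -integral_row// -ge0_integralZl//.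
- by apply/measurable_EFinP; exact: measurable_row.
- by move=> y /O01_lt y01; rewrite lee_fin row_ge0.
- by rewrite lee_fin.
Qed.

Lemma integral_corr_snd (F : R -> R) :
  measurable_fun setT F -> (forall x, 0 <= F x) ->
  (\int[leb \x leb]_(z in O01 `*` O01) ((F z.2)%:E * (corr_dens z)%:E) =
   \int[leb]_(x in O01) (F x * (f x - g x))%:E)%E.
Proof.
move=> mF F0; rewrite tonelli_on2//; last 2 first.
- apply: emeasurable_funM; apply/measurable_EFinP.
    by apply: measurable_funTS; exact: measurableT_comp.
  exact: measurable_corr_dens.
- by move=> z zO; rewrite -EFinM lee_fin mulr_ge0 ?corr_dens_ge0.
apply: eq_integral => x /set_mem /O01_lt x01 /=.
rewrite EFinM -integral_row// -ge0_integralZl//.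
- by apply: eq_integral => y _; rewrite corr_densC.
- by apply/measurable_EFinP; exact: measurable_row.
- by move=> y /O01_lt y01; rewrite lee_fin row_ge0.
- by rewrite lee_fin.
Qed.

Lemma integral_gdens1 : (\int[leb]_(x in O01) (g x)%:E = G1%:E)%E.
Proof.
by have := @integral_gdens R f mf f0 fint reg 1; rewrite ltr01 lexx divr1; apply.
Qed.

Let f_ge_g x : O01 x -> 0 <= f x - g x.
Proof.
move=> /O01_lt x01; rewrite -lee_fin -integral_row//.
by apply: integral_ge0 => y /O01_lt y01; rewrite lee_fin row_ge0.
Qed.

(** Of the two boundary segments, the one at own value 1 returns to the atom the mass G1 subtracted
    at (1,1); the other supplies the density g missing from the interior. *)
Let marginal_sum (F : R -> R) : measurable_fun setT F -> (forall x, 0 <= F x) ->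
  (p0%:E * (F 0)%:E + \int[leb]_(x in O01) (F x * (f x - g x))%:E
   + \int[leb]_(x in O01) ((F 1)%:E * (g x)%:E)
   + \int[leb]_(x in O01) ((F x)%:E * (g x)%:E) + (p1 - G1)%:E * (F 1)%:E
  = (p0 * F 0 + p1 * F 1)%:E + \int[leb]_(x in O01) (F x * f x)%:E)%E.
Proof.
move=> mF F0; have mFO := measurable_funTS mF : measurable_fun (@O01 R) F.
have -> : (\int[leb]_(x in O01) ((F 1)%:E * (g x)%:E) = (F 1)%:E * G1%:E)%E.
  rewrite ge0_integralZl ?integral_gdens1 ?lee_fin//; exact/measurable_EFinP.
have -> : (\int[leb]_(x in O01) (F x * f x)%:E =
    \int[leb]_(x in O01) (F x * (f x - g x))%:E
    + \int[leb]_(x in O01) ((F x)%:E * (g x)%:E))%E.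
  rewrite -ge0_integralD//.
  - by apply: eq_integral => x _; rewrite -EFinM -EFinD -mulrDr subrK.
  - by move=> x /f_ge_g ?; rewrite lee_fin mulr_ge0.
  - by apply/measurable_EFinP/measurable_funM => //; exact: measurable_funB.
  - by move=> x /g0 ?; rewrite -EFinM lee_fin mulr_ge0.
  - by apply/measurable_EFinP; exact: measurable_funM.
set A := integral _ _ _; set B := integral _ _ _.
have -> (a k c : \bar R) : (a + A + k + B + c = a + k + c + (A + B))%E.
  by rewrite (addeAC _ B) (addeAC a) (addeAC (a + k)%E) -[LHS]addeA.
rewrite -!EFinM -!EFinD; congr (_%:E + _)%E; ring.
Qed.

Lemma corr_integral_fst (F : R -> R) :
  measurable_fun setT F -> (forall x, 0 <= F x) ->
  corr_integral (fun z => (F z.1)%:E) =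
  ((p0 * F 0 + p1 * F 1)%:E + \int[leb]_(x in O01) (F x * f x)%:E)%E.
Proof. by move=> mF F0; rewrite /corr_integral integral_corr_fst// marginal_sum. Qed.

Lemma corr_integral_snd (F : R -> R) :
  measurable_fun setT F -> (forall x, 0 <= F x) ->
  corr_integral (fun z => (F z.2)%:E) =
  ((p0 * F 0 + p1 * F 1)%:E + \int[leb]_(x in O01) (F x * f x)%:E)%E.
Proof.
move=> mF F0; rewrite /corr_integral integral_corr_snd//= -marginal_sum//.
by congr (_ + _)%E; rewrite addeAC.
Qed.

Lemma corr_integral_indic (A : set (R * R)) : measurable A ->
  corr_integral (fun z => (\1_A z)%:E) = pistar_fun p0 p1 f A.
Proof.
move=> mA; rewrite /corr_integral /pistar_fun.
congr (_ + _ + _ + _ + _)%E.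
rewrite [RHS]integral_mkcondl; apply: eq_integral => z _.
by rewrite patchE indicE; case: ifPn => _; rewrite ?mul1e ?mul0e.
Qed.

Lemma Fmeas_indic (A : set R) : measurable A -> Fmeas p0 p1 f A =
  ((p0 * \1_A 0 + p1 * \1_A 1)%:E + \int[leb]_(x in O01) (\1_A x * f x)%:E)%E.
Proof.
move=> mA; rewrite /Fmeas; congr (_ + _)%E.
rewrite [LHS]integral_mkcondl; apply: eq_integral => x _.
by rewrite patchE indicE; case: ifPn => _; rewrite ?mul1r ?mul0r.
Qed.

Lemma correlation_structure :
  ((p0 + p1)%:E + \int[leb]_(x in O01) (f x)%:E = 1)%E ->
  exists P : probability (R * R)%type R,
  [/\ forall F, measurable_fun setT F -> (forall z, 0 <= F z)%E ->
        (\int[P]_z F z = corr_integral F)%E,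
      forall A, measurable A -> P A = pistar_fun p0 p1 f A &
      PiF p0 p1 f P].
Proof.
move=> mass1; have [nu nuE] := corr_measure_exists.
have nuA (A : set (R * R)) : measurable A ->
    nu A = corr_integral (fun z => (\1_A z)%:E).
  move=> mA; rewrite -integral_indicT// nuE//; exact: measurableT_comp.
(* The constant 1, read as a function of the first coordinate, turns the total mass into that of the
   marginal. *)
have nu1 : nu setT = 1%E.
  rewrite nuA// (_ : (fun z => _) = (fun z => ((cst 1 : R -> R) z.1)%:E)).
    by rewrite corr_integral_fst// /cst !mulr1; under eq_integral do rewrite mul1r.
  by apply/funext => z; rewrite indicT.
have [P PE] := probability_of_measure ((0, 0) : R * R) nu1.
exists P; split.
- move=> F mF F0; rewrite -nuE//.
  by apply: eq_measure_integral => A _ _; exact: PE.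
- by move=> A mA; rewrite -corr_integral_indic// -nuA//; exact: PE.
- move=> A mA.
  have mAT : measurable (A `*` [set: R]) by exact: measurableX.
  have mTA : measurable ([set: R] `*` A) by exact: measurableX.
  have mA1 : measurable_fun setT (\1_A : R -> R) by exact: measurable_indic.
  have A0 x : 0 <= (\1_A x : R) by [].
  rewrite (Fmeas_indic mA); split.
    rewrite PE nuA// -corr_integral_fst//; congr corr_integral.
    by apply/funext => -[x y]; rewrite !indicE in_setX in_setT andbT.
  rewrite PE nuA// -corr_integral_snd//; congr corr_integral.
  by apply/funext => -[x y]; rewrite !indicE in_setX in_setT.
Qed.

End correlation_structure.

(** * Revenue from one bidder under the adversarial structure *)

Section bidder_revenue.
Context (R : realType) (p1 : R) (f : R -> R).
Local Notation leb := (@lebesgue_measure R).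
Hypothesis mf : measurable_fun (@O01 R) f.
Hypothesis f0 : forall x, 0 < x < 1 -> 0 <= f x.
Hypothesis fint : (\int[leb]_(x in O01) (f x)%:E < +oo)%E.
Hypothesis reg : forall x y, 0 < x -> x <= y -> y < 1 ->
  x ^+ 2 * f x <= y ^+ 2 * f y.
Local Notation g := (gdens f).
Local Notation G1 := (Rintegral leb O01 (fun s => s ^+ 2 * f s)).
Hypothesis G1_le : G1 <= p1.

Variables q t : R -> R -> R.
Hypothesis q01 : forall x y, 0 <= x <= 1 -> 0 <= y <= 1 -> 0 <= q x y <= 1.
Hypothesis ic : forall x x' y, 0 <= x <= 1 -> 0 <= x' <= 1 -> 0 <= y <= 1 ->
  x * q x' y - t x' y <= x * q x y - t x y.
Hypothesis t0 : forall y, t 0 y = 0.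
Hypothesis mt : measurable_fun setT (fun z : R * R => t z.1 z.2).

Let mO : measurable (@O01 R). Proof. exact: measurable_itv. Qed.

Let W (y : R) : O01 y -> 0 <= y <= 1.
Proof. by move=> /O01_lt /andP[/ltW -> /ltW]. Qed.

Let one01 : 0 <= (1 : R) <= 1. Proof. by rewrite lexx ler01. Qed.

Let mty y : measurable_fun setT (t ^~ y).
Proof. exact: (measurableT_comp mt (@pair2_measurable _ _ R R y)). Qed.

Let mtx x : measurable_fun setT (t x).
Proof. exact: (measurableT_comp mt (@pair1_measurable _ _ R R x)). Qed.

Let t_ge0 x y : 0 <= x <= 1 -> 0 <= y <= 1 -> 0 <= t x y.
Proof.
move=> x01 y01; apply: (@ic_payment_ge0 R (q ^~ y) (t ^~ y)) => // a b a01 b01.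
exact: ic.
Qed.

Let mg : measurable_fun (@O01 R) g. Proof. exact: measurable_gdens. Qed.

Let g0 x : O01 x -> 0 <= g x.
Proof. by move=> /O01_lt; exact: gdens_ge0. Qed.

(** Conditionally on the rival's value [y], only own value 1 contributes. The measurable majorant
    [b] stands in for [q 1 y], which is monotone in the own value only and may fail to be measurable
    in [y]. *)
Lemma bidder_revenue_interior (b : R -> R) :
  measurable_fun (@O01 R) b ->
  (forall y, O01 y -> q 1 y <= b y) ->
  (\int[leb]_(y in O01) \int[leb]_(x in O01) (t x y * corr_dens f (x, y))%:E
   + \int[leb]_(y in O01) (t 1 y * g y)%:E
   <= \int[leb]_(y in O01) (b y * g y)%:E)%E.
Proof.
move=> mb qb.
have mtw : measurable_fun (O01 `*` O01)
    (fun z : R * R => (t z.1 z.2 * corr_dens f z)%:E).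
  apply/measurable_EFinP/measurable_funM; last exact: measurable_corr_dens.
  exact: measurable_funTS.
have tw0 (z : R * R) : (O01 `*` O01) z -> (0 <= (t z.1 z.2 * corr_dens f z)%:E)%E.
  move=> zO; rewrite lee_fin mulr_ge0//; last exact: corr_dens_ge0 zO.
  by case: zO => /W z1 /W z2; exact: t_ge0.
have tw0' x y : O01 x -> O01 y -> (0 <= (t x y * corr_dens f (x, y))%:E)%E.
  by move=> xO yO; apply: (tw0 (x, y)).
have mI := measurable_tonelli_on2 mO mO mtw tw0.
have mtg : measurable_fun (@O01 R) (fun y => (t 1 y * g y)%:E).
  by apply/measurable_EFinP/measurable_funM => //; exact: measurable_funTS (mtx 1).
have tg0 y : O01 y -> (0 <= (t 1 y * g y)%:E)%E.
  by move=> yO; rewrite lee_fin mulr_ge0 ?g0//; exact: t_ge0 one01 (W yO).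
rewrite -ge0_integralD//; last first.
  by move=> y yO; apply: integral_ge0 => x xO; exact: tw0'.
apply: ge0_le_integral => //.
- move=> y yO; rewrite adde_ge0 ?tg0//.
  by apply: integral_ge0 => x xO; exact: tw0'.
- exact: emeasurable_funD.
- exact/measurable_EFinP/measurable_funM.
move=> y yO; have y01 := O01_lt yO.
have row0 x : 0 < x < 1 -> 0 <= corr_dens f (y, x).
  by move=> x01; exact: row_ge0.
(* The value [y] selects the row; own value 1 carries the mass [g y], and the slack is zero by
   [row_virtual_le]. *)
have H : (\int[leb]_(x in O01) (t x y * corr_dens f (y, x))%:E + (g y * t 1 y)%:E
    <= (g y * q 1 y)%:E + \int[leb]_(x in O01) (q x y * cst 0 x)%:E)%E.
  apply: (@revenue_le_top_surplus R (q ^~ y) (t ^~ y)) => //.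
  - by move=> x x01; exact: q01 (W yO).
  - by move=> x x' x01 x'01; exact: ic (W yO).
  - exact: measurable_funTS (mty y).
  - exact: measurable_row.
  - by rewrite /corr_dens integral_row// ltry.
  - exact: g0.
  - by move=> s s01; rewrite adde0; exact: row_virtual_le.
have {H} : (\int[leb]_(x in O01) (t x y * corr_dens f (x, y))%:E + (t 1 y * g y)%:E
    <= (q 1 y * g y)%:E)%E.
  rewrite [(t 1 y * _)%R]mulrC [(q 1 y * _)%R]mulrC.
  move: H; under [X in (_ <= _ + X)%E]eq_integral do rewrite mulr0.
  rewrite integral0 adde0; apply: le_trans; rewrite leeD2r//.
  rewrite le_eqVlt; apply/orP; left; apply/eqP.
  by apply: eq_integral => x _; rewrite corr_densC.
by move=> /le_trans; apply; rewrite lee_fin ler_wpM2r ?g0 ?qb.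
Qed.

(** Here the rival has value 1: the row is [g], the atom is the mass at (1,1), and
    [gdens_virtual_le] holds with slack [g]. *)
Lemma bidder_revenue_boundary :
  (\int[leb]_(x in O01) (t x 1 * g x)%:E + ((p1 - G1) * t 1 1)%:E
   <= ((p1 - G1) * q 1 1)%:E + \int[leb]_(x in O01) (q x 1 * g x)%:E)%E.
Proof.
apply: (@revenue_le_top_surplus R (q ^~ 1) (t ^~ 1)) => //.
- by move=> x x01; exact: q01.
- by move=> x x' x01 x'01; exact: ic.
- exact: measurable_funTS (mty 1).
- by rewrite integral_gdens1// ltry.
- by rewrite subr_ge0.
- by move=> s s01; exact: gdens_virtual_le.
Qed.

Lemma bidder_allocation_measurable : measurable_fun (@O01 R) (q ^~ 1).
Proof.
apply: (@ic_measurable R (q ^~ 1) (t ^~ 1)) => x x' x01 x'01; exact: ic.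
Qed.

End bidder_revenue.

Lemma I01E (R : realType) (x : R) : (x \in I01) = (0 <= x <= 1).
Proof. by apply/idP/idP; rewrite inE /I01 /= in_itv. Qed.

(** * Upper bound on the revenue of any mechanism *)

Section optimality.
Context (R : realType) (p0 p1 : R) (f : R -> R).
Local Notation leb := (@lebesgue_measure R).
Hypothesis mf : measurable_fun (@O01 R) f.
Hypothesis f0 : forall x, 0 < x < 1 -> 0 <= f x.
Hypothesis fint : (\int[leb]_(x in O01) (f x)%:E < +oo)%E.
Hypothesis reg : forall x y, 0 < x -> x <= y -> y < 1 ->
  x ^+ 2 * f x <= y ^+ 2 * f y.
Local Notation g := (gdens f).
Local Notation G1 := (Rintegral leb O01 (fun s => s ^+ 2 * f s)).
Hypothesis G1_le : G1 <= p1.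

Let mO : measurable (@O01 R). Proof. exact: measurable_itv. Qed.
Let mOO : measurable (@O01 R `*` @O01 R). Proof. exact: measurableX. Qed.

Let W (y : R) : O01 y -> 0 <= y <= 1.
Proof. by move=> /O01_lt /andP[/ltW -> /ltW]. Qed.

Let zero01 : 0 <= (0 : R) <= 1. Proof. by rewrite lexx ler01. Qed.
Let one01 : 0 <= (1 : R) <= 1. Proof. by rewrite lexx ler01. Qed.

Let mg : measurable_fun (@O01 R) g. Proof. exact: measurable_gdens. Qed.

Let g0 x : O01 x -> 0 <= g x.
Proof. by move=> /O01_lt; exact: gdens_ge0. Qed.

Variables q1 q2 t1 t2 : R * R -> R.
Hypotheses (mt1 : measurable_fun setT t1) (mt2 : measurable_fun setT t2).
Hypotheses (feas : feasible q1 q2) (dsic : DSIC q1 q2 t1 t2).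
Hypothesis epir : EPIR q1 q2 t1 t2.

(* Payments are raised until the lowest type of each bidder gets utility zero;
   the bidder's own value is the first argument. *)
Let s1 x y := t1 (x, y) - t1 (0, y).
Let s2 y x := t2 (x, y) - t2 (x, 0).
Let r1 x y := q1 (x, y).
Let r2 y x := q2 (x, y).

Let feas' x y : 0 <= x <= 1 -> 0 <= y <= 1 ->
  [/\ 0 <= q1 (x, y) <= 1, 0 <= q2 (x, y) <= 1 & q1 (x, y) + q2 (x, y) <= 1].
Proof. by move=> x01 y01; apply: feas; rewrite /= I01E. Qed.

Let r1_01 x y : 0 <= x <= 1 -> 0 <= y <= 1 -> 0 <= r1 x y <= 1.
Proof. by move=> x01 y01; case: (feas' x01 y01). Qed.

Let r2_01 x y : 0 <= x <= 1 -> 0 <= y <= 1 -> 0 <= r2 x y <= 1.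
Proof. by move=> x01 y01; case: (feas' y01 x01). Qed.

Let ic1 x x' y : 0 <= x <= 1 -> 0 <= x' <= 1 -> 0 <= y <= 1 ->
  x * r1 x' y - s1 x' y <= x * r1 x y - s1 x y.
Proof.
move=> x01 x'01 y01; case: dsic => + _ => /(_ x y x').
by rewrite !I01E => /(_ x01 y01 x'01); rewrite /r1 /s1; lra.
Qed.

Let ic2 x x' y : 0 <= x <= 1 -> 0 <= x' <= 1 -> 0 <= y <= 1 ->
  x * r2 x' y - s2 x' y <= x * r2 x y - s2 x y.
Proof.
move=> x01 x'01 y01; case: dsic => _ /(_ y x x').
by rewrite !I01E => /(_ y01 x01 x'01); rewrite /r2 /s2; lra.
Qed.

Let s1_0 y : s1 0 y = 0. Proof. by rewrite /s1 subrr. Qed.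
Let s2_0 y : s2 0 y = 0. Proof. by rewrite /s2 subrr. Qed.

Let ms1 : measurable_fun setT (fun z : R * R => s1 z.1 z.2).
Proof.
apply: measurable_funB.
- by apply: (measurableT_comp mt1); apply: measurable_fun_pair.
- by apply: (measurableT_comp mt1); apply: measurable_fun_pair.
Qed.

Let ms2 : measurable_fun setT (fun z : R * R => s2 z.1 z.2).
Proof.
apply: measurable_funB.
- by apply: (measurableT_comp mt2); apply: measurable_fun_pair.
- by apply: (measurableT_comp mt2); apply: measurable_fun_pair.
Qed.

Let ms2C : measurable_fun setT (fun z : R * R => s2 z.2 z.1).
Proof.
apply: measurable_funB.
- by apply: (measurableT_comp mt2); apply: measurable_fun_pair.
- by apply: (measurableT_comp mt2); apply: measurable_fun_pair.
Qed.

Let s1_ge0 x y : 0 <= x <= 1 -> 0 <= y <= 1 -> 0 <= s1 x y.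
Proof.
move=> x01 y01; exact: (@ic_payment_ge0 R (r1 ^~ y) (s1 ^~ y)
  (fun a b a01 b01 => ic1 a01 b01 y01) (s1_0 y) x x01).
Qed.

Let s2_ge0 x y : 0 <= x <= 1 -> 0 <= y <= 1 -> 0 <= s2 x y.
Proof.
move=> x01 y01; exact: (@ic_payment_ge0 R (r2 ^~ y) (s2 ^~ y)
  (fun a b a01 b01 => ic2 a01 b01 y01) (s2_0 y) x x01).
Qed.

(** The positive part of the total payment, so that the integral formula for nonnegative functions
    applies. *)
Let F (z : R * R) : R := Num.max (t1 z + t2 z) 0.

(** Individual rationality at own value 0 makes [t1 (0, y)] and [t2 (x, 0)] nonpositive, so
    subtracting them raises the payments. *)
Let F_le x y : 0 <= x <= 1 -> 0 <= y <= 1 -> F (x, y) <= s1 x y + s2 y x.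
Proof.
move=> x01 y01; rewrite ge_max; apply/andP; split; last first.
  by rewrite addr_ge0 ?s1_ge0 ?s2_ge0.
have [||H1 _] := epir (v := (0, y)); rewrite ?I01E//.
have [||_ H2] := epir (v := (x, 0)); rewrite ?I01E//.
by move: H1 H2; rewrite /= !mul0r /s1 /s2; lra.
Qed.

Let F00 : F (0, 0) = 0.
Proof.
apply/eqP; rewrite eq_le; apply/andP; split; last by rewrite le_max lexx orbT.
by rewrite (le_trans (F_le zero01 zero01))// s1_0 s2_0 addr0.
Qed.

Let F_ge0 z : 0 <= F z. Proof. by rewrite le_max lexx orbT. Qed.

Let mF : measurable_fun setT F.
Proof. by apply: measurable_maxr => //; exact: measurable_funD. Qed.

Let interior_split :
  (\int[leb \x leb]_(z in O01 `*` O01) ((F z)%:E * (corr_dens f z)%:E)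
  <= \int[leb]_(y in O01) \int[leb]_(x in O01) (s1 x y * corr_dens f (x, y))%:E
   + \int[leb]_(x in O01) \int[leb]_(y in O01) (s2 y x * corr_dens f (y, x))%:E)%E.
Proof.
have mcd : measurable_fun (O01 `*` O01) (corr_dens f).
  exact: measurable_corr_dens.
have cd0 z : (O01 `*` O01) z -> 0 <= corr_dens f z by exact: corr_dens_ge0.
pose A1 (z : R * R) := (s1 z.1 z.2 * corr_dens f z)%:E.
pose A2 (z : R * R) := (s2 z.2 z.1 * corr_dens f z)%:E.
have mA1 : measurable_fun (O01 `*` O01) A1.
  by apply/measurable_EFinP/measurable_funM => //; exact: measurable_funTS ms1.
have mA2 : measurable_fun (O01 `*` O01) A2.
  by apply/measurable_EFinP/measurable_funM => //; exact: measurable_funTS ms2C.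
have A1_ge0 z : (O01 `*` O01) z -> (0 <= A1 z)%E.
  move=> zO; rewrite lee_fin mulr_ge0 ?cd0//.
  by case: zO => /W z1 /W z2; exact: s1_ge0.
have A2_ge0 z : (O01 `*` O01) z -> (0 <= A2 z)%E.
  move=> zO; rewrite lee_fin mulr_ge0 ?cd0//.
  by case: zO => /W z1 /W z2; exact: s2_ge0.
have <- : (\int[leb \x leb]_(z in O01 `*` O01) A1 z =
    \int[leb]_(y in O01) \int[leb]_(x in O01) (s1 x y * corr_dens f (x, y))%:E)%E.
  by rewrite tonelli_on2.
have <- : (\int[leb \x leb]_(z in O01 `*` O01) A2 z =
    \int[leb]_(x in O01) \int[leb]_(y in O01) (s2 y x * corr_dens f (y, x))%:E)%E.
  rewrite tonelli_on1//; apply: eq_integral => x _; apply: eq_integral => y _.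
  by rewrite /A2 /= corr_densC.
rewrite -ge0_integralD//; apply: ge0_le_integral => //.
- by move=> z zO; rewrite -EFinM lee_fin mulr_ge0 ?cd0.
- by apply/measurable_EFinP/measurable_funM => //; exact: measurable_funTS mF.
- exact: emeasurable_funD.
- move=> z zO; rewrite -EFinM -EFinD lee_fin -mulrDl ler_wpM2r ?cd0//.
  by case: z zO => x y [/W xO /W yO]; exact: F_le.
Qed.

Let segment_split (h k1 k2 : R -> R) :
  measurable_fun setT h -> measurable_fun setT k1 -> measurable_fun setT k2 ->
  (forall x, 0 <= h x) ->
  (forall x, O01 x -> 0 <= k1 x) -> (forall x, O01 x -> 0 <= k2 x) ->
  (forall x, O01 x -> h x <= k1 x + k2 x) ->
  (\int[leb]_(x in O01) ((h x)%:E * (g x)%:E)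
   <= \int[leb]_(x in O01) (k1 x * g x)%:E + \int[leb]_(x in O01) (k2 x * g x)%:E)%E.
Proof.
move=> mh mk1 mk2 h0 k10 k20 hk.
have mk (k : R -> R) : measurable_fun setT k ->
    measurable_fun (@O01 R) (fun x => (k x * g x)%:E).
  by move=> kk; apply/measurable_EFinP/measurable_funM => //; exact: measurable_funTS kk.
rewrite -ge0_integralD//; last 4 first.
- by move=> x xO; rewrite lee_fin mulr_ge0 ?k10 ?g0.
- exact: mk.
- by move=> x xO; rewrite lee_fin mulr_ge0 ?k20 ?g0.
- exact: mk.
apply: ge0_le_integral => //.
- by move=> x xO; rewrite -EFinM lee_fin mulr_ge0 ?g0.
- exact: mk.
- by apply: emeasurable_funD; exact: mk.
- by move=> x xO; rewrite -EFinM -EFinD lee_fin -mulrDl ler_wpM2r ?g0 ?hk.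
Qed.

Let m1x (k : R -> R -> R) x : measurable_fun setT (fun z : R * R => k z.1 z.2) ->
  measurable_fun setT (k x).
Proof. by move=> mk; exact: (measurableT_comp mk (@pair1_measurable _ _ R R x)). Qed.

Let m2x (k : R -> R -> R) y : measurable_fun setT (fun z : R * R => k z.1 z.2) ->
  measurable_fun setT (k ^~ y).
Proof. by move=> mk; exact: (measurableT_comp mk (@pair2_measurable _ _ R R y)). Qed.

(** Here [b] is the probability that a bidder wins against a rival with value 1. It weights that
    bidder's slack, and [1 - b] bounds what is left for the rival. *)
Let slack_sum (b : R -> R) : measurable_fun (@O01 R) b ->
  (forall x, O01 x -> 0 <= b x <= 1) ->
  (\int[leb]_(x in O01) ((1 - b x) * g x)%:E + \int[leb]_(x in O01) (b x * g x)%:E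
   = G1%:E)%E.
Proof.
move=> mb b01; rewrite -(integral_gdens1 mf f0 fint reg) -ge0_integralD//.
- by apply: eq_integral => x _; rewrite -EFinD -mulrDl subrK mul1r.
- move=> x xO; rewrite lee_fin mulr_ge0 ?g0// subr_ge0.
  by case/andP: (b01 x xO).
- by apply/measurable_EFinP/measurable_funM => //; exact: measurable_funB.
- move=> x xO; rewrite lee_fin mulr_ge0 ?g0//.
  by case/andP: (b01 x xO).
- exact/measurable_EFinP/measurable_funM.
Qed.

(** At the profile (1, y) bidder 1 wins with probability at most [1 - r2 y 1], while bidder 2's
    slack is weighted by [r2 y 1]: together they yield the integral of g, which is G1. The mirror
    segment yields G1 again, and the atom at (1,1) at most p1 - G1. *)
Lemma corr_integral_payments_le :
  (corr_integral p0 p1 f (fun z => (F z)%:E) <= (p1 + G1)%:E)%E.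
Proof.
have mr1 := bidder_allocation_measurable ic1.
have mr2 := bidder_allocation_measurable ic2.
have mb (b : R -> R) : measurable_fun (@O01 R) b ->
    measurable_fun (@O01 R) (fun x => 1 - b x).
  by move=> mb; exact: measurable_funB.
(* The majorant [1 - r2 y 1] is measurable because [r2 y 1] is monotone in bidder 2's own value
   [y]. *)
have I1 := @bidder_revenue_interior R f mf f0 fint reg r1 s1 r1_01 ic1 s1_0 ms1
  (fun y => 1 - r2 y 1) (mb _ mr2).
have I2 := @bidder_revenue_interior R f mf f0 fint reg r2 s2 r2_01 ic2 s2_0 ms2
  (fun x => 1 - r1 x 1) (mb _ mr1).
have B1 := @bidder_revenue_boundary R p1 f mf f0 fint reg G1_le r1 s1 r1_01 ic1 s1_0 ms1.
have B2 := @bidder_revenue_boundary R p1 f mf f0 fint reg G1_le r2 s2 r2_01 ic2 s2_0 ms2.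
have {I1} /I1 : forall y, O01 y -> r1 1 y <= 1 - r2 y 1.
  move=> y /W y01; have [_ _] := feas' one01 y01.
  by rewrite /r1 /r2; lra.
have {I2} /I2 : forall x, O01 x -> r2 1 x <= 1 - r1 x 1.
  move=> y /W y01; have [_ _] := feas' y01 one01.
  by rewrite /r1 /r2; lra.
have S1 := slack_sum mr1 (fun x xO => r1_01 (W xO) one01).
have S2 := slack_sum mr2 (fun x xO => r2_01 (W xO) one01).
have J1 : (\int[leb]_(x in O01) ((F (1, x))%:E * (g x)%:E)
    <= \int[leb]_(x in O01) (s1 1 x * g x)%:E
     + \int[leb]_(x in O01) (s2 x 1 * g x)%:E)%E.
  apply: segment_split.
  - exact: (measurableT_comp mF (@pair1_measurable _ _ R R 1)).
  - exact: m1x.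
  - exact: m2x.
  - by [].
  - by move=> x /W x01; exact: s1_ge0.
  - by move=> x /W x01; exact: s2_ge0.
  - by move=> x /W x01; exact: F_le.
have J2 : (\int[leb]_(x in O01) ((F (x, 1))%:E * (g x)%:E)
    <= \int[leb]_(x in O01) (s1 x 1 * g x)%:E
     + \int[leb]_(x in O01) (s2 1 x * g x)%:E)%E.
  apply: segment_split.
  - exact: (measurableT_comp mF (@pair2_measurable _ _ R R 1)).
  - exact: m2x.
  - exact: m1x.
  - by [].
  - by move=> x /W x01; exact: s1_ge0.
  - by move=> x /W x01; exact: s2_ge0.
  - by move=> x /W x01; exact: F_le.
have m0 : 0 <= p1 - G1 by rewrite subr_ge0.
have J3 : ((p1 - G1)%:E * (F (1, 1))%:E
    <= ((p1 - G1) * s1 1 1)%:E + ((p1 - G1) * s2 1 1)%:E)%E.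
  by rewrite -EFinM -EFinD lee_fin -mulrDr ler_wpM2l// F_le.
have E0 : (p0%:E * (F (0, 0)%R)%:E = 0)%E by rewrite F00 mule0.
have E1 : (((p1 - G1) * r1 1 1)%:E + ((p1 - G1) * r2 1 1)%:E <= (p1 - G1)%:E)%E.
  rewrite -EFinD lee_fin -mulrDr ler_piMr//.
  by have [_ _] := feas' one01 one01.
move=> {}I2 {}I1; rewrite /corr_integral E0 add0e.
apply: le_trans (leeD (leeD (leeD interior_split J1) J2) J3) _.
move: I1 I2 B1 B2 S1 S2 E1.
set a1 := (X in (X + _ <= _)%E -> _); set c1 := (X in (_ + X <= _)%E -> _).
set b1 := (X in (_ <= X)%E -> _).
move=> I1.
set a2 := (X in (X + _ <= _)%E -> _); set c2 := (X in (_ + X <= _)%E -> _).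
set b2 := (X in (_ <= X)%E -> _).
move=> I2.
set d1 := (X in (X + _ <= _)%E -> _); set h1 := (X in (_ <= _ + X)%E -> _).
move=> B1.
set d2 := (X in (X + _ <= _)%E -> _); set h2 := (X in (_ <= _ + X)%E -> _).
move=> B2 S1 S2 E1.
(* First the terms are grouped by bidder, to apply the individual bounds. *)
have -> (e1 e2 : \bar R) : (a1 + a2 + (c1 + d2) + (d1 + c2) + (e1 + e2) =
    ((a1 + c1) + (d1 + e1)) + ((a2 + c2) + (d2 + e2)))%E.
  by rewrite (addeACA a1) -[LHS]addeA (addeACA d1) addeACA (addeACA a2).
apply: le_trans (leeD (leeD I1 B1) (leeD I2 B2)) _.
(* Now each interior bound is paired with the other bidder's slack, as in [S1] and [S2]. *)
have -> (e1 e2 : \bar R) : (b1 + (e1 + h1) + (b2 + (e2 + h2)) =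
    (b1 + h2) + (b2 + h1) + (e1 + e2))%E.
  rewrite (addeCA b1) (addeCA b2) addeACA [LHS]addeC; congr (_ + _)%E.
  by rewrite (addeC b2 h2) addeACA (addeC h1).
rewrite S1 S2; apply: le_trans (leeD2l _ E1) _.
by rewrite -!EFinD lee_fin; lra.
Qed.

Lemma dsic_revenue_le (P : probability (R * R)%type R) :
  (forall F, measurable_fun setT F -> (forall z, 0 <= F z)%E ->
    (\int[P]_z F z = corr_integral p0 p1 f F)%E) ->
  (revenue t1 t2 P <= (p1 + G1)%:E)%E.
Proof.
move=> PE; apply: le_trans corr_integral_payments_le.
rewrite -PE; last 2 first.
- exact/measurable_EFinP.
- by move=> z; rewrite lee_fin.
rewrite /revenue integralE.
(* Dropping the negative part only increases the integral, so non-integrable payments are covered as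
   well. *)
apply: (@le_trans _ _ (\int[P]_v ((fun v => (t1 v + t2 v)%:E)^\+ v))%E).
  by rewrite geeDl// oppe_le0; exact: integral_ge0.
rewrite le_eqVlt; apply/orP; left; apply/eqP.
by apply: eq_integral => z _; rewrite funeposE /F EFin_max.
Qed.

End optimality.

(** * The second price auction with uniform reserves *)

Section uniform_reserves.
Context (R : realType).

(** The sum separates the two values, so its expectation depends on the marginals only. *)
Lemma tstar_sum (v : R * R) : tstar1 v + tstar2 v = v.1 ^+ 2 / 2 + v.2 ^+ 2 / 2.
Proof. by rewrite /tstar1 /tstar2; case: ltgtP => [_|_|->]; lra. Qed.

Lemma qstar_feasible : feasible (@qstar1 R) (@qstar2 R).
Proof.
move=> [x y] /=; rewrite !I01E => /andP[x0 x1] /andP[y0 y1].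
by rewrite /qstar1 /qstar2 /=; case: ltgtP => [_|_|xy]; split; lra.
Qed.

(** With value x, a winning report z against y yields (x^2 - y^2 - (x - z)^2) / 2: this is largest
    at z = x, and negative for every z when x < y. A tying report z = y yields y (x - y) / 2. *)
Lemma tstar_DSIC : DSIC (@qstar1 R) (@qstar2 R) (@tstar1 R) (@tstar2 R).
Proof.
split=> x y z; rewrite !I01E => /andP[x0 x1] /andP[y0 y1] /andP[z0 z1].
  rewrite /qstar1 /tstar1 /=.
  have := sqr_ge0 (x - z); have := sqr_ge0 (x - y); have := sqr_ge0 (y - z).
  rewrite !expr2 => h1 h2 h3.
  case: (ltgtP y z) => [yz|zy|yz]; case: (ltgtP y x) => [yx|xy|yx]; subst; nra.
rewrite /qstar2 /tstar2 /=.
have := sqr_ge0 (y - z); have := sqr_ge0 (x - y); have := sqr_ge0 (x - z).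
rewrite !expr2 => h1 h2 h3.
case: (ltgtP x z) => [xz|zx|xz]; case: (ltgtP x y) => [xy|yx|xy]; subst; nra.
Qed.

Lemma tstar_EPIR : EPIR (@qstar1 R) (@qstar2 R) (@tstar1 R) (@tstar2 R).
Proof.
move=> [x y] /=; rewrite !I01E => /andP[x0 x1] /andP[y0 y1].
rewrite /qstar1 /qstar2 /tstar1 /tstar2 /=.
by case: ltgtP => [xy|yx|xy]; split; subst; nra.
Qed.

Lemma tstar_revenue (p0 p1 : R) (f : R -> R) (P : probability (R * R)%type R) :
  0 <= p0 -> 0 <= p1 -> measurable_fun (@O01 R) f ->
  (forall x, 0 < x < 1 -> 0 <= f x) -> PiF p0 p1 f P ->
  (revenue (@tstar1 R) (@tstar2 R) P =
   p1%:E + \int[@lebesgue_measure R]_(x in O01) (x ^+ 2 * f x)%:E)%E.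
Proof.
move=> p0_ge0 p1_ge0 mf f0 piP.
pose F (x : R) := x ^+ 2 / 2.
have mF : measurable_fun setT F by exact: measurable_funM.
have F0 x : 0 <= F x by rewrite divr_ge0 ?sqr_ge0.
have P1 A : measurable A -> P (fst @^-1` A) = Fmeas p0 p1 f A.
  move=> mA; have [<- _] := piP A mA; congr (P _).
  by apply/seteqP; split => -[x y] //= [].
have P2 A : measurable A -> P (snd @^-1` A) = Fmeas p0 p1 f A.
  move=> mA; have [_ <-] := piP A mA; congr (P _).
  by apply/seteqP; split => -[x y] //= [].
rewrite /revenue; under eq_integral do rewrite tstar_sum EFinD.
rewrite ge0_integralD//; last 4 first.
- by move=> v _; rewrite lee_fin; exact: (F0 v.1).
- by apply/measurable_EFinP; exact: (measurableT_comp mF measurable_fst).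
- by move=> v _; rewrite lee_fin; exact: (F0 v.2).
- by apply/measurable_EFinP; exact: (measurableT_comp mF measurable_snd).
rewrite (integral_marginal p0_ge0 p1_ge0 mf f0 measurable_fst P1 mF F0).
rewrite (integral_marginal p0_ge0 p1_ge0 mf f0 measurable_snd P2 mF F0).
rewrite addeACA -EFinD; congr (_%:E + _)%E; first by rewrite /F; lra.
have Ff0 x : O01 x -> (0 <= (F x * f x)%:E)%E.
  by move=> /O01_lt x01; rewrite lee_fin mulr_ge0 ?f0.
have mFf : measurable_fun (@O01 R) (fun x => (F x * f x)%:E).
  by apply/measurable_EFinP/measurable_funM => //; exact: measurable_funTS mF.
rewrite -ge0_integralD//; last exact: measurable_itv.
by apply: eq_integral => x _; rewrite -EFinD /F; congr EFin; lra.
Qed.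

End uniform_reserves.

(** * The saddle point and the revenue guarantee *)

Theorem theorem1 (R : realType) (p0 p1 : R) (f : R -> R) :
  marginal_ok p0 p1 f ->
  (* regularity: x^2 f(x) non-decreasing on (0,1) *)
  (forall x y : R, 0 < x -> x <= y -> y < 1 -> x ^+ 2 * f x <= y ^+ 2 * f y) ->
  (* regularity: Pr(1) >= \int_(0,1) x^2 f(x) dx *)
  (\int[@lebesgue_measure R]_(x in @O01 R) (x ^+ 2 * f x)%:E <= p1%:E)%E ->
  exists pistar : probability (R * R)%type R,
    (forall A : set (R * R), measurable A -> pistar A = pistar_fun p0 p1 f A) /\
    [/\ pistar \in PiF p0 p1 f,
        feasible (@qstar1 R) (@qstar2 R) /\
          DSIC (@qstar1 R) (@qstar2 R) (@tstar1 R) (@tstar2 R) /\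
          EPIR (@qstar1 R) (@qstar2 R) (@tstar1 R) (@tstar2 R),
        (forall pi, pi \in PiF p0 p1 f ->
           (revenue (@tstar1 R) (@tstar2 R) pistar
              <= revenue (@tstar1 R) (@tstar2 R) pi)%E),
        (forall q1 q2 t1 t2 : R * R -> R,
           measurable_fun setT t1 -> measurable_fun setT t2 ->
           feasible q1 q2 -> DSIC q1 q2 t1 t2 -> EPIR q1 q2 t1 t2 ->
           (revenue t1 t2 pistar <= revenue (@tstar1 R) (@tstar2 R) pistar)%E) &
        ereal_inf [set revenue (@tstar1 R) (@tstar2 R) pi | pi in PiF p0 p1 f]
          = (p1%:E + \int[@lebesgue_measure R]_(x in @O01 R) (x ^+ 2 * f x)%:E)%E].
Proof.
move=> [[p0_ge0 p1_ge0 mf f0 mass1] _] reg hG.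
have fint : (\int[@lebesgue_measure R]_(x in O01) (f x)%:E < +oo)%E.
  by move: mass1; case: integral => //= r _; exact: ltry.
have G1E := @integral_h R f mf f0 fint 1 (lexx 1).
have G1_le : Rintegral lebesgue_measure O01 (fun s => s ^+ 2 * f s) <= p1.
  by rewrite -lee_fin -G1E.
have [P [PE PA PPi]] := correlation_structure p0_ge0 mf f0 fint reg G1_le mass1.
have rev (Q : probability (R * R)%type R) : Q \in PiF p0 p1 f ->
    (revenue (@tstar1 R) (@tstar2 R) Q =
     p1%:E + \int[@lebesgue_measure R]_(x in @O01 R) (x ^+ 2 * f x)%:E)%E.
  by move=> /set_mem; exact: tstar_revenue.
have PIn : P \in PiF p0 p1 f by exact: mem_set.
exists P; split; first exact: PA.
split => //.
- by split; [exact: qstar_feasible|split; [exact: tstar_DSIC|exact: tstar_EPIR]].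
- by move=> Q QIn; rewrite !rev.
- move=> q1 q2 t1 t2 mt1 mt2 feas dsic epir; rewrite rev// G1E -EFinD.
  exact: (dsic_revenue_le mf f0 fint reg G1_le mt1 mt2 feas dsic epir PE).
(* The revenue is constant on [PiF], and [P] shows that this set is inhabited, so the set of
   revenues is a singleton. *)
- rewrite (_ : [set _ | _ in _] = [set (p1%:E +
    \int[@lebesgue_measure R]_(x in @O01 R) (x ^+ 2 * f x)%:E)%E]) ?ereal_inf1//.
  apply/seteqP; split => [_ [Q QPi <-]|_ ->] /=.
    by apply: rev; exact: mem_set.
  by exists P => //; exact: rev.
Qed.
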